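(* An operator $\Delta$ of order $\leq 2$ (and weight $\lambda$) in the algebra of densities $\mathfrak V(M)$ is equivalent to a quadratic pencil of operators $$\Delta_w=\Delta_0+wA+w^2B,\qquad w\in\mathbb R,$$ where $\Delta_w$ is the restriction of $\Delta$ to densities of weight $w$ (written in local coordinates as acting on coefficients), $\Delta_0$ is an operator of order $\leq 2$ acting on functions, and $A$ and $B$ are operators of order $\leq 1$ and $0$ respectively. ($A$ and $B$ do not make sense independently of $\Delta_0$.)
   Context: Let $M$ be a supermanifold (an ordinary manifold is allowed) with local coordinates $x^a$; the atlas is such that all Jacobians (Berezinians) are positive. A density of weight $w\in\mathbb R$ is locally $\psi(x)(Dx)^w$. The algebra of densities $\mathfrak V(M)$ consists of finite formal sums of densities of arbitrary real weights, with the tensor product as multiplication. Densities are identified with functions on $\hat M=(\operatorname{Ber}TM)\setminus M$ with local coordinates $x^a,t$, where $t$ corresponds to $Dx$: $\sum_w\psi_w(x)(Dx)^w\leftrightarrow\sum_w\psi_w(x)t^w$. Differential operators in $\mathfrak V(M)$ are understood as differential operators on $\hat M$. An operator $\Delta$ has weight $\lambda$ if it maps densities of weight $w$ to densities of weight $w+\lambda$ for all $w$; it is then given by the family (pencil) of operators $\Delta_w$, where in local coordinates $\Delta(\psi(x)(Dx)^w)=(\Delta_w\psi)(x)\,(Dx)^{w+\lambda}$. The operators $\Delta_0,A,B$ in the statement are differential operators in $x$ in the given local coordinates, independent of $w$ (so the decomposition is coordinate dependent). Order $\leq k$ means that all $(k+1)$-fold commutators with multiplication operators vanish. *)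

(* Defs.v *)
From HB Require Import structures.
From mathcomp Require Import all_boot all_order all_algebra.
From mathcomp Require Import ring.
Set Implicit Arguments.
Unset Strict Implicit.
Unset Printing Implicit Defensive.
Import Order.TTheory GRing.Theory Num.Theory.
Local Open Scope ring_scope.

(* The Grassmann algebra on q generators: f is the sum of the f I theta_I,
   where theta_I is the product of the generators of index in I, taken in
   increasing order. *)
Section Grassmann.
Variables (R : comNzRingType) (q : nat).
Implicit Types I J K L : {set 'I_q}.

Definition grass : Type := {ffun {set 'I_q} -> R^o}.
HB.instance Definition _ :=
  GRing.Lmodule.copy grass {ffun {set 'I_q} -> R^o}.
Implicit Types f g h : grass.

Definition inversions J K : nat :=
  #|[set jk : 'I_q * 'I_q | [&& jk.1 \in J, jk.2 \in K & (jk.2 < jk.1)%N]]|.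

Definition gone : grass := [ffun I : {set 'I_q} => (I == set0)%:R].

Definition gmul f g : grass :=
  [ffun I => \sum_(J in powerset I)
     (-1) ^+ inversions J (I :\: J) * (f J * g (I :\: J))].

Lemma inversionsUl J K L : [disjoint J & K] ->
  inversions (J :|: K) L = (inversions J L + inversions K L)%N.
Proof.
move=> dJK; rewrite /inversions -cardsUI [X in (_ = _ + X)%N]eq_card0 ?addn0.
  by apply: eq_card => -[a b]; rewrite !inE /=; case: (a \in J) => //=;
    case: (a \in K); case: (b \in L); case: (b < a)%N.
move=> -[a b]; rewrite !inE /=; case aJ : (a \in J) => //=.
by rewrite (disjointFr dJK aJ) /= andbF.
Qed.

Lemma inversionsUr J K L : [disjoint K & L] ->
  inversions J (K :|: L) = (inversions J K + inversions J L)%N.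
Proof.
move=> dKL; rewrite /inversions -cardsUI [X in (_ = _ + X)%N]eq_card0 ?addn0.
  by apply: eq_card => -[a b]; rewrite !inE /=; case: (a \in J) => //=;
    case: (b \in K); case: (b \in L); case: (b < a)%N.
move=> -[a b]; rewrite !inE /=; case bK : (b \in K) => //=;
  last by rewrite andbF.
by rewrite (disjointFr dKL bK) /= !andbF.
Qed.

Lemma inversions0l K : inversions set0 K = 0%N.
Proof. by apply: eq_card0 => x; rewrite !inE. Qed.

Lemma inversions0r K : inversions K set0 = 0%N.
Proof. by apply: eq_card0 => x; rewrite !inE andbF. Qed.

Lemma gmulA : associative gmul.
Proof.
move=> f g h; apply/ffunP => I; rewrite !ffunE.
under eq_bigr => J _ do rewrite ffunE mulr_sumr mulr_sumr.
under [RHS]eq_bigr => M _ do rewrite ffunE mulr_suml mulr_sumr.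
rewrite [RHS](exchange_big_dep (fun J => J \in powerset I)) /=; last first.
  by move=> M J; rewrite !powersetE => MI JM; exact: subset_trans MI.
apply: eq_bigr => J; rewrite powersetE => JI.
rewrite [RHS](reindex_onto (fun K => J :|: K) (fun M => M :\: J)) /=; last first.
  move=> M /andP[_]; rewrite powersetE => JM.
  apply/setP => x; rewrite !inE; case xJ : (x \in J) => //=.
  by rewrite (subsetP JM _ xJ).
apply: eq_big => K.
  rewrite !powersetE subUset JI subsetUl andbT /=.
  apply/idP/andP => [|[/= KI /eqP KE]].
    rewrite subsetD => /andP[KI dKJ]; split => //.
    rewrite setDUl setDv set0U.
    by apply/eqP/setDidPl.
  rewrite subsetD KI /= -KE -setI_eq0; apply/eqP/setP => x.
  by rewrite !inE; case: (x \in J); rewrite /= ?andbF.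
rewrite powersetE subsetD => /andP[KI dKJ].
have JKJ : (J :|: K) :\: J = K.
  rewrite setDUl setDv set0U.
  by apply/setDidPl.
rewrite JKJ setDDl.
set L := I :\: (J :|: K).
have dJK : [disjoint J & K] by rewrite disjoint_sym.
have -> : I :\: J = K :|: L.
  apply/setP => x; rewrite !inE; case xK : (x \in K) => //=.
  - by rewrite (disjointFr dKJ xK) (subsetP KI _ xK).
  - by rewrite orbF.
have dKL : [disjoint K & L].
  rewrite -setI_eq0; apply/eqP/setP => x; rewrite !inE.
  by case: (x \in K); rewrite /= ?orbT.
rewrite inversionsUl // inversionsUr // !exprD.
move: (_ ^+ _) (_ ^+ _) (_ ^+ _) => a b c.
move: (f J : R) (g K : R) (h L : R) => x y z.
by rewrite /= /GRing.scale /=; ring.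
Qed.

Lemma gmul1l : left_id gone gmul.
Proof.
move=> f; apply/ffunP => I; rewrite ffunE (bigD1 set0) /=; last first.
  by rewrite powersetE sub0set.
rewrite big1 ?addr0 => [|J /andP[_ J0]]; last first.
  by rewrite ffunE (negbTE J0) mul0r mulr0.
by rewrite inversions0l ffunE eqxx !mul1r setD0.
Qed.

Lemma gmul1r : right_id gone gmul.
Proof.
move=> f; apply/ffunP => I; rewrite ffunE (bigD1 I) /=; last first.
  by rewrite powersetE.
rewrite big1 ?addr0 => [|J /andP[]]; last first.
  rewrite powersetE => JI JnI; rewrite ffunE.
  rewrite setD_eq0; case: (boolP (I \subset J)) => [IJ|_]; last first.
    by rewrite !mulr0.
  by case/negP: JnI; rewrite eqEsubset JI.
by rewrite setDv inversions0r ffunE eqxx mulr1 mul1r.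
Qed.

Lemma gmulDl : left_distributive gmul +%R.
Proof.
move=> f g h; apply/ffunP => I; rewrite !ffunE -big_split /=.
by apply: eq_bigr => J _; rewrite !ffunE mulrDl mulrDr.
Qed.

Lemma gmulDr : right_distributive gmul +%R.
Proof.
move=> f g h; apply/ffunP => I; rewrite !ffunE -big_split /=.
by apply: eq_bigr => J _; rewrite !ffunE mulrDr mulrDr.
Qed.

Fact gmul0l : left_zero 0 gmul.
Proof. by move=> f; apply: (addrI (gmul 0 f)); rewrite -gmulDl !addr0. Qed.

Fact gmul0r : right_zero 0 gmul.
Proof. by move=> f; apply: (addrI (gmul f 0)); rewrite -gmulDr !addr0. Qed.

HB.instance Definition _ := GRing.Nmodule_isPzSemiRing.Build grass
  gmulA gmul1l gmul1r gmulDl gmulDr gmul0l gmul0r.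

Lemma grass_mulE f g I : (f * g) I = \sum_(J in powerset I)
  (-1) ^+ inversions J (I :\: J) * (f J * g (I :\: J)).
Proof. by rewrite ffunE. Qed.

Definition gbody f : R := f set0.

Definition ginvol f : grass := [ffun I : {set 'I_q} => (-1) ^+ #|I| * f I].

Definition ggen (j : 'I_q) : grass := [ffun I : {set 'I_q} => (I == [set j])%:R].

(* the left derivative with respect to the j-th generator *)
Definition gderiv (j : 'I_q) f : grass :=
  [ffun I : {set 'I_q} => if j \in I then 0
             else (-1) ^+ #|[set i in I | (i < j)%N]| * f (j |: I)].

End Grassmann.

From mathcomp Require Import all_classical all_reals all_analysis.
Import numFieldNormedType.Exports.
Local Open Scope classical_set_scope.

Section Smooth.
Variables (R : realType) (p : nat).
Implicit Types (f g : 'rV[R]_p -> R) (x : 'rV[R]_p).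

Definition partial (i : 'I_p) f : 'rV[R]_p -> R := 'D_(delta_mx 0 i) f.

Definition pderivable (i : 'I_p) f x : Prop := derivable f x (delta_mx 0 i).

Lemma pderivable_near f g i x : (\forall y \near x, f y = g y) ->
  pderivable i f x -> pderivable i g x.
Proof. exact: near_eq_derivable. Qed.

Lemma pderivableD f g i x : pderivable i f x -> pderivable i g x ->
  pderivable i (f + g) x /\ partial i (f + g) x = partial i f x + partial i g x.
Proof.
move=> df dg; split; [exact (derivableD df dg)|exact (deriveD df dg)].
Qed.

Lemma pderivableM f g i x : pderivable i f x -> pderivable i g x ->
  pderivable i (f * g) x /\
  partial i (f * g) x = f x * partial i g x + g x * partial i f x.
Proof.
move=> df dg; split; [exact (derivableM df dg)|exact (deriveM df dg)].
Qed.

(* f is of class C^k on some neighborhood of x *)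
Fixpoint Ck_at (k : nat) f x : Prop :=
  (\forall y \near x, {for y, continuous f}) /\
  if k is k'.+1 then
    forall i : 'I_p, (\forall y \near x, pderivable i f y) /\
                     Ck_at k' (partial i f) x
  else True.

Definition smooth_at f x : Prop := forall k, Ck_at k f x.

Lemma near2 (P : 'rV[R]_p -> Prop) x :
  (\forall y \near x, P y) -> \forall y \near x, \forall z \near y, P z.
Proof. exact: nbhs_interior. Qed.

Lemma continuous_near f g x : (\forall y \near x, f y = g y) ->
  {for x, continuous f} -> {for x, continuous g}.
Proof.
move=> fg cf; rewrite /prop_for /continuous_at -(nbhs_singleton fg).
exact: cvg_trans (near_eq_cvg fg) cf.
Qed.

Lemma partial_near f g i x : (\forall y \near x, f y = g y) ->
  \forall y \near x, partial i f y = partial i g y.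
Proof.
move=> /near2 fg; near=> y; apply: near_eq_derive.
by near: y.
Unshelve. all: by end_near. Qed.

Lemma Ck_at_near k f g x :
  (\forall y \near x, f y = g y) -> Ck_at k f x -> Ck_at k g x.
Proof.
elim: k f g => [|k IH] f g fg /= [cf df].
  split=> //; have fg2 := near2 fg; near=> y.
  by apply: (@continuous_near f); near: y.
split.
  have fg2 := near2 fg; near=> y.
  by apply: (@continuous_near f); near: y.
move=> i; have [dfi Dfi] := df i; split; last first.
  by apply: IH Dfi; apply: partial_near.
have fg2 := near2 fg; near=> y.
apply: (@pderivable_near f); first by near: y.
by near: y.
Unshelve. all: by end_near. Qed.

Lemma Ck_atS k f x : Ck_at k.+1 f x -> Ck_at k f x.
Proof.
elim: k f => [|k IH] f /= [cf df]; first by split.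
by split=> // i; have [dfi Dfi] := df i; split=> //; apply: IH.
Qed.

Lemma Ck_at_cst k (c : R) x : Ck_at k (cst c) x.
Proof.
elim: k c => [|k IH] c /=.
  by split=> //; near=> y; apply: cst_continuous.
split; first by near=> y; apply: cst_continuous.
move=> i; split; first by near=> y; apply: derivable_cst.
suff -> : partial i (cst c) = cst 0 by apply: IH.
by apply/funext => y; rewrite /partial derive_cst.
Unshelve. all: by end_near. Qed.

Lemma Ck_atD k f g x : Ck_at k f x -> Ck_at k g x -> Ck_at k (f + g) x.
Proof.
elim: k f g => [|k IH] f g /= [cf df] [cg dg].
  split=> //; near=> y; have cfy : {for y, continuous f} by near: y.
  have cgy : {for y, continuous g} by near: y.
  exact: continuousD.
split.
  near=> y; have cfy : {for y, continuous f} by near: y.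
  have cgy : {for y, continuous g} by near: y.
  exact: continuousD.
move=> i; have [dfi Dfi] := df i; have [dgi Dgi] := dg i; split.
  apply: filterS2 dfi dgi => y df1 dg1.
  by have [] := pderivableD df1 dg1.
apply: Ck_at_near (IH _ _ Dfi Dgi); apply: filterS2 dfi dgi => y df1 dg1.
by have [_ ->] := pderivableD df1 dg1.
Unshelve. all: by end_near. Qed.

Lemma Ck_atM k f g x : Ck_at k f x -> Ck_at k g x -> Ck_at k (f * g) x.
Proof.
elim: k f g => [|k IH] f g Cf Cg.
  case: Cf Cg => [cf _] [cg _].
  split=> //; near=> y; have cfy : {for y, continuous f} by near: y.
  have cgy : {for y, continuous g} by near: y.
  exact: continuousM.
have [Cf' Cg'] := (Ck_atS Cf, Ck_atS Cg).
case: Cf Cg => [cf df] [cg dg].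
split.
  near=> y; have cfy : {for y, continuous f} by near: y.
  have cgy : {for y, continuous g} by near: y.
  exact: continuousM.
move=> i; have [dfi Dfi] := df i; have [dgi Dgi] := dg i; split.
  apply: filterS2 dfi dgi => y df1 dg1.
  by have [] := pderivableM df1 dg1.
apply: Ck_at_near (Ck_atD (IH _ _ Cf' Dgi) (IH _ _ Cg' Dfi)).
apply: filterS2 dfi dgi => y df1 dg1.
by have [_ ->] := pderivableM df1 dg1.
Unshelve. all: by end_near. Qed.

Lemma Ck_at_coord k (i : 'I_p) x : Ck_at k (fun y => y 0 i) x.
Proof.
pose c (y : 'rV[R]_p) : R^o := y 0 i.
have linc : linear c by move=> a u v; rewrite /c !mxE.
pose cL := HB.pack_for {linear 'rV[R]_p -> R^o} c
  (GRing.isLinear.Build _ _ _ _ c linc).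
have cc : continuous c by exact: coord_continuous.
have dc y : differentiable c y by exact: (@linear_differentiable _ _ _ cL).
case: k => [|k] /=; first by split=> //; near=> y; apply: cc.
split; first by near=> y; apply: cc.
move=> j; split; first by near=> y; apply: diff_derivable; apply: dc.
suff -> : partial j (fun y => y 0 i) = cst ((delta_mx 0 j : 'rV[R]_p) 0 i).
  exact: Ck_at_cst.
apply/funext => y; rewrite /partial deriveE; last exact: dc.
by rewrite (@diff_lin _ _ _ cL).
Unshelve. all: by end_near. Qed.

Lemma smooth_at_near f g x :
  (\forall y \near x, f y = g y) -> smooth_at f x -> smooth_at g x.
Proof. by move=> fg Cf k; apply: Ck_at_near (Cf k). Qed.

Lemma smooth_at_cst (c : R) x : smooth_at (cst c) x.
Proof. by move=> k; apply: Ck_at_cst. Qed.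

Lemma smooth_atD f g x :
  smooth_at f x -> smooth_at g x -> smooth_at (fun y => f y + g y) x.
Proof. by move=> Cf Cg k; apply: Ck_atD. Qed.

Lemma smooth_atM f g x :
  smooth_at f x -> smooth_at g x -> smooth_at (fun y => f y * g y) x.
Proof. by move=> Cf Cg k; apply: Ck_atM. Qed.

Lemma smooth_at_sum (T : Type) (s : seq T) (P : pred T)
    (F : T -> 'rV[R]_p -> R) x :
  (forall t, P t -> smooth_at (F t) x) ->
  smooth_at (fun y => \sum_(t <- s | P t) F t y) x.
Proof.
move=> CF; elim: s => [|t s IH].
  rewrite (_ : (fun y => _) = cst 0); first exact: smooth_at_cst.
  by apply/funext => y; rewrite big_nil.
rewrite (_ : (fun y => _) = fun y => (if P t then F t y else 0) +
  \sum_(u <- s | P u) F u y); last first.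
  by apply/funext => y; rewrite big_cons; case: ifP => // _; rewrite add0r.
apply: smooth_atD => //; case Pt : (P t); first exact: CF.
exact: (smooth_at_cst 0).
Qed.

Lemma smooth_at_partial f i x : smooth_at f x -> smooth_at (partial i f) x.
Proof. by move=> Cf k; have [_ /(_ i) []] := Cf k.+1. Qed.

End Smooth.

(* Superfunctions on the superdomain with body U in R^p and q odd coordinates.
   To give equal superfunctions equal underlying maps, they are extended by 0
   outside U.  Only open sets U matter; using the interior spares a proof of
   openness in the type. *)
Section SuperFunctions.
Variables (R : realType) (p q : nat).
Implicit Types (U : set 'rV[R]_p) (x : 'rV[R]_p).
Notation rawfun := ('rV[R]_p -> grass R q).

Definition is_superfun U (F : rawfun) : Prop :=
  (forall x, U° x -> forall I, smooth_at (fun y => F y I) x) /\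
  (forall x, ~ U° x -> F x = 0).

Definition superfun_pred U : pred rawfun := fun F => `[< is_superfun U F >].

Record superfun U := SuperFun {
  superfun_val :> rawfun;
  _ : superfun_pred U superfun_val
}.

HB.instance Definition _ U := [isSub for @superfun_val U].
HB.instance Definition _ U := [Choice of superfun U by <:].

Lemma superfunP U (F : superfun U) : is_superfun U F.
Proof. by case: F => F /= /asboolP. Qed.

Lemma superfun_inj U (F G : superfun U) : (forall x, F x = G x) -> F = G.
Proof. by move=> FG; apply/val_inj/funext. Qed.

Definition mk_superfun U F (FP : is_superfun U F) : superfun U :=
  @SuperFun U F (asboolT FP).

Fact superfun_submod U : submod_closed (superfun_pred U).
Proof.
split=> [|a F G /asboolP[sF zF] /asboolP[sG zG]]; apply/asboolP; split.
- move=> x _ I; rewrite (_ : (fun y => _) = cst 0); first exact: smooth_at_cst.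
  by apply/funext => y; rewrite ffunE.
- by [].
- move=> x Ux I.
  rewrite (_ : (fun y => _) = fun y => cst a y * F y I + G y I); last first.
    by apply/funext => y; rewrite !ffunE.
  by apply: smooth_atD; [apply: smooth_atM; [exact: smooth_at_cst|exact: sF]
                        |exact: sG].
- move=> x Ux.
  by rewrite [LHS](_ : _ = a *: F x + G x) // zF // zG // scaler0 addr0.
Qed.

HB.instance Definition _ U := GRing.isSubmodClosed.Build R rawfun
  (superfun_pred U) (GRing.submod_closed_semi (superfun_submod U)).
HB.instance Definition _ U := [SubChoice_isSubLmodule of superfun U by <:].

Definition cutoff U (F : rawfun) : rawfun :=
  fun x => if `[< U° x >] then F x else 0.

Lemma is_superfun_cutoff U (F : rawfun) :
  (forall x, U° x -> forall I, smooth_at (fun y => F y I) x) ->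
  is_superfun U (cutoff U F).
Proof.
move=> sF; split=> x Ux; last by rewrite /cutoff asboolF.
move=> I; apply: smooth_at_near (sF x Ux I).
by apply: filterS (nbhs_interior Ux) => y Uy; rewrite /cutoff asboolT.
Qed.

Definition sf_cst U (a : grass R q) : superfun U :=
  mk_superfun (is_superfun_cutoff (fun x _ I => smooth_at_cst (a I) x)).

Fact is_superfun_mul U (F G : superfun U) : is_superfun U (fun x => F x * G x).
Proof.
have [[sF zF] [sG zG]] := (superfunP F, superfunP G).
split=> [x Ux I|x Ux]; last by rewrite zF // mul0r.
rewrite (_ : (fun y => _) = fun y => \sum_(J in powerset I)
   cst ((-1) ^+ inversions J (I :\: J)%SET) y *
   (F y J * G y (I :\: J)%SET)); last first.
  by apply/funext => y; rewrite grass_mulE.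
apply: smooth_at_sum => J _; apply: smooth_atM; first exact: smooth_at_cst.
by apply: smooth_atM; [exact: sF|exact: sG].
Qed.

Definition sf_mul U (F G : superfun U) : superfun U :=
  mk_superfun (is_superfun_mul F G).

Fact sf_mulA U : associative (@sf_mul U).
Proof. by move=> F G H; apply: superfun_inj => x /=; rewrite mulrA. Qed.

Fact sf_mul1l U : left_id (sf_cst U 1) (@sf_mul U).
Proof.
move=> F; apply: superfun_inj => x /=; rewrite /cutoff.
case: asboolP => Ux; first by rewrite mul1r.
by rewrite mul0r (superfunP F).2.
Qed.

Fact sf_mul1r U : right_id (sf_cst U 1) (@sf_mul U).
Proof.
move=> F; apply: superfun_inj => x /=; rewrite /cutoff.
case: asboolP => Ux; first by rewrite mulr1.
by rewrite mulr0 (superfunP F).2.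
Qed.

Fact sf_mulDl U : left_distributive (@sf_mul U) +%R.
Proof. by move=> F G H; apply: superfun_inj => x; apply: mulrDl. Qed.

Fact sf_mulDr U : right_distributive (@sf_mul U) +%R.
Proof. by move=> F G H; apply: superfun_inj => x; apply: mulrDr. Qed.

Fact sf_mul0l U : left_zero 0 (@sf_mul U).
Proof. by move=> F; apply: superfun_inj => x; apply: mul0r. Qed.

Fact sf_mul0r U : right_zero 0 (@sf_mul U).
Proof. by move=> F; apply: superfun_inj => x; apply: mulr0. Qed.

HB.instance Definition _ U := GRing.Nmodule_isPzSemiRing.Build (superfun U)
  (@sf_mulA U) (@sf_mul1l U) (@sf_mul1r U) (@sf_mulDl U) (@sf_mulDr U)
  (@sf_mul0l U) (@sf_mul0r U).

Fact is_superfun_invol U (F : superfun U) :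
  is_superfun U (fun x => ginvol (F x)).
Proof.
have [sF zF] := superfunP F; split=> [x Ux I|x Ux].
  rewrite (_ : (fun y => _) = fun y => cst ((-1) ^+ #|I|) y * F y I).
    by apply: smooth_atM; [exact: smooth_at_cst|exact: sF].
  by apply/funext => y; rewrite ffunE.
by rewrite zF //; apply/ffunP => I; rewrite !ffunE mulr0.
Qed.

Definition sf_invol U (F : superfun U) : superfun U :=
  mk_superfun (is_superfun_invol F).

(* Coordinates, and the corresponding (left) partial derivatives, are indexed
   by 'I_p + 'I_q: inl for the even ones, inr for the odd ones. *)
Definition raw_coord (a : 'I_p + 'I_q) : rawfun :=
  match a with
  | inl i => fun x => x 0 i *: (1 : grass R q)
  | inr j => fun _ => ggen R j
  end.

Fact smooth_at_raw_coord a x (I : {set 'I_q}) :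
  smooth_at (fun y => raw_coord a y I) x.
Proof.
case: a => [i|j] /=; last exact: smooth_at_cst.
rewrite (_ : (fun y => _) = fun y : 'rV[R]_p => y 0 i * cst ((1 : grass R q) I) y).
  by apply: smooth_atM; [move=> k; exact: Ck_at_coord|exact: smooth_at_cst].
by apply/funext => y; rewrite !ffunE.
Qed.

Definition sf_coord U a : superfun U :=
  mk_superfun (is_superfun_cutoff (fun x _ => smooth_at_raw_coord a x)).

Definition raw_deriv (a : 'I_p + 'I_q) (F : rawfun) : rawfun :=
  match a with
  | inl i => fun x => [ffun I => partial i (fun y => F y I) x]
  | inr j => fun x => gderiv j (F x)
  end.

Fact smooth_at_raw_deriv a U (F : superfun U) x : U° x ->
  forall I, smooth_at (fun y => raw_deriv a F y I) x.
Proof.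
have [sF _] := superfunP F => Ux I; case: a => [i|j] /=.
  rewrite (_ : (fun y => _) = partial i (fun y => F y I)).
    by apply: smooth_at_partial; apply: sF.
  by apply/funext => y; rewrite ffunE.
case Ij : (j \in I).
  rewrite (_ : (fun y => _) = cst 0); first exact: smooth_at_cst.
  by apply/funext => y; rewrite ffunE Ij.
rewrite (_ : (fun y => _) = fun y =>
  cst ((-1) ^+ #|[set i in I | (i < j)%N]%SET|) y * F y (j |: I)%SET).
  by apply: smooth_atM; [exact: smooth_at_cst|exact: sF].
by apply/funext => y; rewrite ffunE Ij.
Qed.

Definition sf_deriv U a (F : superfun U) : superfun U :=
  mk_superfun (is_superfun_cutoff (smooth_at_raw_deriv a F)).

Fact is_superfun_restr U W (F : superfun U) (WU : W `<=` U) :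
  is_superfun W (cutoff W F).
Proof.
apply: is_superfun_cutoff => x Wx; apply: (superfunP F).1.
exact: interiorS Wx.
Qed.

Definition sf_restr U W (WU : W `<=` U) (F : superfun U) : superfun W :=
  mk_superfun (is_superfun_restr F WU).

End SuperFunctions.

(* The algebra of densities over a superdomain: psi stands for the finite
   formal sum of the psi w t^w, where t corresponds to Dx. *)
Section Densities.
Variables (R : realType) (p q : nat) (U : set 'rV[R]_p).
Notation rawdens := (R -> superfun q U).

Definition weights (f : rawdens) : set R := [set w | f w != 0].

Definition densities_pred : pred rawdens := fun f => `[< finite_set (weights f) >].

Record densities := Densities {
  densities_val :> rawdens;
  _ : densities_pred densities_val
}.

HB.instance Definition _ := [isSub for densities_val].
HB.instance Definition _ := [Choice of densities by <:].

Lemma densitiesP (f : densities) : finite_set (weights f).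
Proof. by case: f => f /= /asboolP. Qed.

Lemma densities_inj (f g : densities) : (forall w, f w = g w) -> f = g.
Proof. by move=> fg; apply/val_inj/funext. Qed.

Definition mk_densities f (fP : finite_set (weights f)) : densities :=
  @Densities f (asboolT fP).

Fact densities_submod : submod_closed densities_pred.
Proof.
split=> [|a f g /asboolP ff /asboolP fg]; apply/asboolP.
  by apply: (@sub_finite_set _ _ set0) => // w; rewrite /weights /= eqxx.
apply: (@sub_finite_set _ _ (weights f `|` weights g)); last first.
  by rewrite finite_setU.
move=> w; rewrite /weights /=; apply: contra_neqP.
move=> /not_orP[/negP/negPn/eqP fw /negP/negPn/eqP gw].
by rewrite [LHS](_ : _ = a *: f w + g w) // fw gw scaler0 addr0.
Qed.

HB.instance Definition _ := GRing.isSubmodClosed.Build R rawdens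
  densities_pred (GRing.submod_closed_semi densities_submod).
HB.instance Definition _ := [SubChoice_isSubLmodule of densities by <:].

Fact finite_weights_mono w (F : superfun q U) :
  finite_set (weights (fun u => if u == w then F else 0)).
Proof.
apply: (@sub_finite_set _ _ [set w]) => // u.
by rewrite /weights /=; case: (u =P w) => //; rewrite eqxx.
Qed.

(* F t^w *)
Definition dmono w (F : superfun q U) : densities :=
  mk_densities (finite_weights_mono w F).

Definition raw_dmul (f g : rawdens) : rawdens :=
  fun w => \sum_(u \in weights f) f u * g (w - u).

Lemma raw_dmulE (s : seq R) f g w : uniq s -> weights f `<=` [set` s] ->
  raw_dmul f g w = \sum_(u <- s) f u * g (w - u).
Proof.
move=> us fs; rewrite fsbig_seq //.
apply: fsbig_widen => // u [_] /= /negP.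
by rewrite negbK => /eqP ->; rewrite mul0r.
Qed.

Lemma finite_weights_seq (f : rawdens) : finite_set (weights f) ->
  exists2 s, uniq s & weights f `<=` [set` s].
Proof.
by move=> /finite_seqP[s ->]; exists (undup s); rewrite ?undup_uniq // => u /=;
  rewrite mem_undup.
Qed.

Lemma raw_dmul_weights (s t : seq R) f g :
  weights f `<=` [set` s] -> weights g `<=` [set` t] ->
  weights (raw_dmul f g) `<=` [set` [seq a + b | a <- s, b <- t]].
Proof.
move=> fs gt w; apply: contraPP => /= nw; apply/negP; rewrite negbK.
rewrite /raw_dmul fsbig1 // => u fu.
case: (eqVneq (g (w - u)) 0) => [->|gwu]; first by rewrite mulr0.
case: nw; apply/allpairsP; exists (u, w - u) => /=.
by split; [exact: fs|exact: gt|rewrite addrC subrK].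
Qed.

Fact finite_weights_dmul (f g : densities) :
  finite_set (weights (raw_dmul f g)).
Proof.
have [s _ fs] := finite_weights_seq (densitiesP f).
have [t _ gt] := finite_weights_seq (densitiesP g).
exact: sub_finite_set (raw_dmul_weights fs gt) (finite_seq _).
Qed.

Definition dmul (f g : densities) : densities :=
  mk_densities (finite_weights_dmul f g).

Fact dmulA : associative dmul.
Proof.
move=> f g h; apply: densities_inj => w /=.
have [s us fs] := finite_weights_seq (densitiesP f).
have [t _ gt] := finite_weights_seq (densitiesP g).
pose r := undup [seq a + b | a <- s, b <- t].
rewrite (raw_dmulE _ _ us fs) [RHS](@raw_dmulE r) ?undup_uniq //; last first.
  by move=> u /(raw_dmul_weights fs gt) ust; rewrite /= mem_undup.
under [RHS]eq_bigr => u _ do rewrite (raw_dmulE _ _ us fs) mulr_suml.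
rewrite exchange_big /= big_seq [RHS]big_seq; apply: eq_bigr => a sa.
rewrite (@raw_dmulE [seq u - a | u <- r]); first last.
- move=> b /gt /= tb; apply/mapP; exists (a + b); last by rewrite addrC addKr.
  by rewrite mem_undup; apply/allpairsP; exists (a, b).
- by rewrite map_inj_uniq ?undup_uniq //; exact: addIr.
rewrite big_map mulr_sumr; apply: eq_bigr => u _.
by rewrite mulrA opprB addrA subrK.
Qed.

Fact dmul1l : left_id (dmono 0 1) dmul.
Proof.
move=> f; apply: densities_inj => w /=.
rewrite (@raw_dmulE [:: 0]) ?big_seq1 /= ?eqxx ?mul1r ?subr0 //.
by move=> u; rewrite /weights /= inE; case: (u == 0) => //; rewrite eqxx.
Qed.

Fact dmul1r : right_id (dmono 0 1) dmul.
Proof.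
move=> f; apply: densities_inj => w /=.
have [s _ fs] := finite_weights_seq (densitiesP f).
rewrite (@raw_dmulE (undup (w :: s))) ?undup_uniq //; last first.
  move=> u /fs us; change (u \in undup (w :: s)).
  by rewrite mem_undup inE; apply/orP; right; exact: us.
rewrite (bigD1_seq w) ?undup_uniq ?mem_undup ?mem_head //=.
rewrite subrr eqxx mulr1 big1 ?addr0 // => u uw.
by rewrite subr_eq0 eq_sym (negbTE uw) mulr0.
Qed.

Lemma common_weights (f g : densities) : exists2 s, uniq s &
  weights f `<=` [set` s] /\ weights g `<=` [set` s].
Proof.
have [s _ fs] := finite_weights_seq (densitiesP f).
have [t _ gt] := finite_weights_seq (densitiesP g).
exists (undup (s ++ t)); first exact: undup_uniq.
by split=> u; [move=> /fs|move=> /gt] => us;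
  rewrite /= mem_undup mem_cat us ?orbT.
Qed.

Fact dmulDl : left_distributive dmul +%R.
Proof.
move=> f g h; apply: densities_inj => w.
have [s us [fs gs]] := common_weights f g.
have fgs : weights (f + g) `<=` [set` s].
  move=> u; apply: contraPP => /= nu; apply/negP; rewrite negbK.
  rewrite [X in X == _](_ : _ = f u + g u) //.
  have /eqP -> : f u == 0 by apply/negPn/negP => /fs.
  have /eqP -> : g u == 0 by apply/negPn/negP => /gs.
  by rewrite addr0.
rewrite [RHS](_ : _ = raw_dmul f h w + raw_dmul g h w) //.
rewrite [LHS](_ : _ = raw_dmul (f + g) h w) // !(@raw_dmulE s) // -big_split.
by apply: eq_bigr => u _; exact: mulrDl.
Qed.

Fact dmulDr : right_distributive dmul +%R.
Proof.
move=> f g h; apply: densities_inj => w.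
have [s us fs] := finite_weights_seq (densitiesP f).
rewrite [RHS](_ : _ = raw_dmul f g w + raw_dmul f h w) //.
rewrite [LHS](_ : _ = raw_dmul f (g + h) w) // !(@raw_dmulE s) // -big_split.
by apply: eq_bigr => u _; exact: mulrDr.
Qed.

HB.instance Definition _ := GRing.Zmodule_isPzRing.Build densities
  dmulA dmul1l dmul1r dmulDl dmulDr.

Fact finite_weights_map (D : superfun q U -> superfun q U) (f : densities) :
  D 0 = 0 -> finite_set (weights (fun w => D (f w))).
Proof.
move=> D0; apply: sub_finite_set (densitiesP f) => w.
by rewrite /weights /=; apply: contra_neq => ->.
Qed.

Fact sf_invol0 : @sf_invol R p q U 0 = 0.
Proof.
by apply: superfun_inj => x; apply/ffunP => I; rewrite !ffunE mulr0.
Qed.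

Fact sf_deriv0 a : @sf_deriv R p q U a 0 = 0.
Proof.
apply: superfun_inj => x /=; rewrite /cutoff; case: ifP => // _.
apply/ffunP => I; case: a => [i|j]; rewrite !ffunE.
  rewrite (_ : (fun y => _) = cst 0); last first.
    by apply/funext => y; rewrite ffunE.
  by rewrite /partial derive_cst; symmetry; exact: ffunE.
by case: ifP; rewrite ?mulr0.
Qed.

Definition dinvol (f : densities) : densities :=
  mk_densities (finite_weights_map f sf_invol0).

Definition dderiv a (f : densities) : densities :=
  mk_densities (finite_weights_map f (sf_deriv0 a)).

Fact finite_weights_dt (f : densities) :
  finite_set (weights (fun w => (w + 1) *: f (w + 1))).
Proof.
have [s _ fs] := finite_weights_seq (densitiesP f).
apply: (@sub_finite_set _ _ [set` [seq u - 1 | u <- s]]); last first.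
  exact: finite_seq.
move=> w; rewrite /weights /= => fw; apply/mapP; exists (w + 1).
  by apply: fs; apply: contra_neq fw => ->; rewrite scaler0.
by rewrite addrK.
Qed.

(* the derivative with respect to t, which maps F t^w to w F t^(w - 1) *)
Definition ddt (f : densities) : densities :=
  mk_densities (finite_weights_dt f).

End Densities.

(* Differential operators in a superalgebra A with parity involution inv and
   given coordinate derivations. *)
Section DifferentialOperators.
Variables (A : pzRingType) (inv : A -> A).
Implicit Types (a x : A) (D : A -> A) (e : bool).

Definition homogeneous e a : Prop := inv a = (-1) ^+ e * a.

(* [D, a] for a of parity e; conjugating D by inv is multiplication by
   (-1)^|D| for homogeneous D, so that this is the supercommutator, extended
   by linearity to inhomogeneous D. *)
Definition supercomm D e a : A -> A :=
  fun x => D (a * x) - a * iter e inv (D (iter e inv x)).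

Fixpoint order_le (k : nat) D : Prop :=
  forall e a, homogeneous e a ->
    if k is k'.+1 then order_le k' (supercomm D e a)
    else forall x, supercomm D e a x = 0.

Inductive diffop (derivations : set (A -> A)) : (A -> A) -> Prop :=
| diffop_mul a : diffop derivations (fun x => a * x)
| diffop_deriv D : derivations D -> diffop derivations D
| diffop_add D1 D2 : diffop derivations D1 -> diffop derivations D2 ->
    diffop derivations (fun x => D1 x + D2 x)
| diffop_comp D1 D2 : diffop derivations D1 -> diffop derivations D2 ->
    diffop derivations (fun x => D1 (D2 x)).

End DifferentialOperators.

Section LocalOperators.
Variables (R : realType) (p q : nat) (U : set 'rV[R]_p).

Definition sf_diffop_le (k : nat) (D : superfun q U -> superfun q U) : Prop :=
  diffop (range (@sf_deriv R p q U)) D /\ order_le (@sf_invol R p q U) k D.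

(* On formal sums the vanishing of commutators alone would also admit
   t^w |-> f w t^w for f additive but not R-linear. *)
Definition dens_diffop_le (k : nat) (D : densities q U -> densities q U) : Prop :=
  diffop (range (@dderiv R p q U) `|` [set @ddt R p q U]) D /\
  order_le (@dinvol R p q U) k D.

End LocalOperators.

Section BerezinianPower.
Variables (R : realType) (p q n : nat).
Implicit Types (J : 'I_p + 'I_q -> 'I_p + 'I_q -> grass R n) (b : grass R n).

Definition is_berezinian J b : Prop :=
  let J00 := \matrix_(i, j) J (inl i) (inl j) in
  let J01 := \matrix_(i, j) J (inl i) (inr j) in
  let J10 := \matrix_(i, j) J (inr i) (inl j) in
  let J11 := \matrix_(i, j) J (inr i) (inr j) in
  exists K : 'M[grass R n]_q,
    [/\ K *m J11 = 1%:M, J11 *m K = 1%:M &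
        b * \det J11 = \det (J00 - J01 *m K *m J10)].

(* 0 when the odd-odd block is not invertible *)
Definition berezinian J : grass R n := xget 0 (is_berezinian J).

(* The Taylor expansion of y |-> y `^ w at the body of b, for an even b with
   positive body; (b - gbody b *: 1) ^+ n.+1 = 0. *)
Definition gpowR b (w : R) : grass R n :=
  \sum_(k < n.+1)
    (\prod_(j < k) (w - j%:R) / k`!%:R * gbody b `^ (w - k%:R)) *:
    (b - gbody b *: (1 : grass R n)) ^+ k.

End BerezinianPower.

(* A supermanifold of dimension p|q given by an atlas: a chart i identifies
   the open subset sm_dom i of the body with an open subset of R^p, and the
   coordinate changes sm_trans i j W, over the open subsets W of
   sm_dom i `&` sm_dom j, are isomorphisms of sheaves of superalgebras. They
   re-express in the coordinates of the chart i what is written in those of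
   the chart j. *)
Record supermanifold (R : realType) (p q : nat) := Supermanifold {
  sm_body : topologicalType;
  sm_hausdorff : hausdorff_space sm_body;
  sm_second_countable : @second_countable sm_body;
  sm_chart : Type;
  sm_dom : sm_chart -> set sm_body;
  sm_map : sm_chart -> sm_body -> 'rV[R]_p;
  sm_dom_open : forall i, open (sm_dom i);
  sm_dom_cover : forall m, exists i, sm_dom i m;
  sm_map_inj : forall i, set_inj (sm_dom i) (sm_map i);
  sm_map_homeo : forall i W, W `<=` sm_dom i ->
    open W <-> open (sm_map i @` W);
  sm_trans : forall i j (W : set sm_body),
    superfun q (sm_map j @` W) -> superfun q (sm_map i @` W);
  sm_trans_linear : forall i j W, open W -> W `<=` sm_dom i `&` sm_dom j ->
    linear (@sm_trans i j W);
  sm_trans_monoid : forall i j W, open W -> W `<=` sm_dom i `&` sm_dom j ->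
    GRing.monoid_morphism (@sm_trans i j W);
  sm_trans_even : forall i j W, open W -> W `<=` sm_dom i `&` sm_dom j ->
    forall F, sm_trans i (sf_invol F) = sf_invol (@sm_trans i j W F);
  sm_trans_restr : forall i j W W', open W -> open W' ->
    W `<=` sm_dom i `&` sm_dom j -> forall (W'W : W' `<=` W) F,
    sm_trans i (sf_restr (image_subset (sm_map j) W'W) F) =
    sf_restr (image_subset (sm_map i) W'W) (@sm_trans i j W F);
  sm_trans_id : forall i W, open W -> W `<=` sm_dom i ->
    forall F, @sm_trans i i W F = F;
  sm_trans_comp : forall i j k W, open W ->
    W `<=` sm_dom i `&` sm_dom j `&` sm_dom k ->
    forall F, sm_trans i (@sm_trans j k W F) = @sm_trans i k W F
}.

Section DensitiesOnManifold.
Variables (R : realType) (p q : nat) (M : supermanifold R p q).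
Implicit Types (i j : sm_chart M) (m : sm_body M) (w lam : R).

Definition sm_image i : set 'rV[R]_p := sm_map i @` sm_dom i.

Definition sm_overlap i j : set (sm_body M) := sm_dom i `&` sm_dom j.

Definition sm_pullback i j (F : superfun q (sm_image j)) :
    superfun q (sm_map i @` sm_overlap i j) :=
  sm_trans i (sf_restr (image_subset (sm_map j)
    (@subIsetr _ (sm_dom i) (sm_dom j))) F).
Arguments sm_pullback : clear implicits.

(* d(coordinates of the chart j)/d(coordinates of the chart i) at m, the row
   index being that of the coordinates of the chart i *)
Definition sm_jacobian i j m (b a : 'I_p + 'I_q) : grass R q :=
  sf_deriv b (sm_pullback i j (@sf_coord R p q (sm_image j) a)) (sm_map i m).

Definition sm_berezinian i j m : grass R q := berezinian (sm_jacobian i j m).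

Definition positive_atlas : Prop :=
  forall i j m, sm_overlap i j m -> 0 < gbody (sm_berezinian i j m).

(* F (Dx_i)^w = G (Dx_j)^w on the overlap of the charts i and j, where
   Dx_j = Ber(dx_j/dx_i) Dx_i *)
Definition agree_weight w i j
    (F : superfun q (sm_image i)) (G : superfun q (sm_image j)) : Prop :=
  forall m, sm_overlap i j m ->
    F (sm_map i m) =
    sm_pullback i j G (sm_map i m) * gpowR (sm_berezinian i j m) w.

Definition agree i j
    (f : densities q (sm_image i)) (g : densities q (sm_image j)) : Prop :=
  forall w, agree_weight w (f w) (g w).

(* An operator in the algebra of densities on M, given by its expressions in
   the charts. *)
Definition density_family : Type :=
  forall i, densities q (sm_image i) -> densities q (sm_image i).

Definition density_operator (Delta : density_family) : Prop :=
  (forall i, linear (Delta i)) /\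
  (forall i j f g, @agree i j f g -> agree (Delta i f) (Delta j g)).

Definition density_diffop_le (k : nat) (Delta : density_family) : Prop :=
  forall i, dens_diffop_le k (Delta i).

Definition has_weight lam (Delta : density_family) : Prop :=
  forall i w F, exists G, Delta i (dmono w F) = dmono (w + lam) G.

Definition pencil_family : Type :=
  R -> forall i, superfun q (sm_image i) -> superfun q (sm_image i).

(* a family of operators P w from densities of weight w to densities of
   weight w + lam, written as acting on coefficients in the charts *)
Definition operator_pencil lam (P : pencil_family) : Prop :=
  (forall w i, linear (P w i)) /\
  (forall w i j F G, @agree_weight w i j F G ->
     agree_weight (w + lam) (P w i F) (P w j G)).

Definition quadratic_pencil (P : pencil_family) : Prop :=
  forall i, exists Delta0 A B : superfun q (sm_image i) -> superfun q (sm_image i),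
    [/\ sf_diffop_le 2 Delta0, sf_diffop_le 1 A, sf_diffop_le 0 B &
        forall w F, P w i F = Delta0 F + w *: A F + w ^+ 2 *: B F].

Definition restricts_to lam (Delta : density_family) (P : pencil_family) : Prop :=
  forall w i F, Delta i (dmono w F) = dmono (w + lam) (P w i F).

End DensitiesOnManifold.

(* Main.v *)
Require Import Defs.
From HB Require Import structures.
From mathcomp Require Import all_boot all_order all_algebra.
From mathcomp Require Import all_classical all_reals all_analysis.
From mathcomp Require Import ring lra.
Set Implicit Arguments.
Unset Strict Implicit.
Unset Printing Implicit Defensive.
Import Order.TTheory GRing.Theory Num.Theory.
Import numFieldNormedType.Exports.
Local Open Scope ring_scope.

(** In a chart, the operator [euler f w = w *: f w] is t d/dt, the derivation
    whose eigenvalues are the weights.  Letting an operator in x act on every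
    coefficient of a density turns D0 + w A + w^2 B into
    D0 + A (t d/dt) + B (t d/dt)^2, and any operator of weight lam with that
    pencil is t^lam times this one.  The Euler operator has order 1, the lift
    of an operator in x keeps its order ([order_lift]), and orders add under
    composition ([order_lt_comp]); hence the orders 2, 1, 0 of D0, A, B give
    an operator of order 2 ([quadratic_pencil_order]).

    Conversely, the supercommutator of an operator with multiplication by t is,
    on pencils, the difference P (w + 1) - P w ([supercomm_dmono1]), and it
    lowers the order by 1.  For an operator of order 2 the third difference of
    the pencil is therefore 0, while the first and second differences at
    w = 0 have orders 1 and 0.  They are A + B and 2 B, which determines
    A, B and their orders, P 0 being D0.  It remains to see that a pencil with
    vanishing third differences is quadratic in w.  Differences alone do not
    give this, since only integral steps are taken; but the pencil of an
    operator generated by multiplications and by the derivations in x and t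
    depends polynomially on w ([dens_diffop_polynomial]), and a polynomial whose
    third differences vanish is quadratic ([poly_third_difference]).

    All of this takes place in one chart.  As every density in a chart is a
    finite sum of monomials, a linear operator is determined by its
    restrictions to them, and a pencil defines an operator weight by weight;
    compatibility with changes of chart is tested weight by weight as well. *)

(** * Supercommutators and the order of operators *)

Section SupercommutatorCalculus.
Variables (A : pzRingType) (inv : {rmorphism A -> A}).
Hypothesis invK : involutive inv.
Implicit Types (D : A -> A) (e : bool) (a b x y : A) (n k l : nat).

(** The order filtration shifted by one: the zero operators form the lowest
    step, so that an induction on the order can start from them and every
    supercommutator lowers the index by exactly 1. *)
Definition order_lt n D : Prop :=
  if n is k.+1 then order_le inv k D else forall x, D x = 0.

Lemma order_ltSE n D : order_lt n.+1 D <->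
  forall e a, homogeneous inv e a -> order_lt n (supercomm inv D e a).
Proof. by case: n. Qed.

(** For homogeneous [D] this is [D] times a sign; [supercomm inv D e a] is the
    difference of D composed with a and a composed with [iconj e D]. *)
Definition iconj e D x := iter e inv (D (iter e inv x)).

Lemma iter_invD e : {morph iter e inv : x y / x + y}.
Proof. by case: e => x y //=; rewrite rmorphD. Qed.

Lemma iter_invM e : {morph iter e inv : x y / x * y}.
Proof. by case: e => x y //=; rewrite rmorphM. Qed.

Lemma iter_inv0 e : iter e inv 0 = 0.
Proof. by case: e => //=; rewrite rmorph0. Qed.

Lemma iter_invB e : {morph iter e inv : x y / x - y}.
Proof. by case: e => x y //=; rewrite rmorphB. Qed.

Lemma iter_invK e : involutive (iter e inv).
Proof. by case: e => x //=; rewrite invK. Qed.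

Lemma iter_invC e e' x : iter e inv (iter e' inv x) = iter e' inv (iter e inv x).
Proof. by case: e; case: e'. Qed.

Lemma homogeneous_iter e e' a :
  homogeneous inv e a -> homogeneous inv e (iter e' inv a).
Proof.
case: e' => //=; rewrite /homogeneous => ha.
by rewrite ha rmorphM rmorphXn rmorphN1 ha.
Qed.

Lemma supercomm_additive D e a : zmod_morphism D ->
  zmod_morphism (supercomm inv D e a).
Proof.
move=> addD x y; rewrite /supercomm mulrBr addD iter_invB addD iter_invB mulrBr.
by rewrite !opprD !opprK addrACA.
Qed.

Lemma order_lt_zero n D : (forall x, D x = 0) -> order_lt n D.
Proof.
elim: n D => // n IH D D0; apply/order_ltSE => e a _.
by apply: IH => x; rewrite /supercomm !D0 iter_inv0 mulr0 subrr.
Qed.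

Lemma order_ltS n D : order_lt n D -> order_lt n.+1 D.
Proof.
elim: n D => [|n IH] D; first exact: order_lt_zero.
by move=> /order_ltSE oD; apply/order_ltSE => e a ha; apply: IH; apply: oD.
Qed.

Lemma order_ltD n D1 D2 : order_lt n D1 -> order_lt n D2 ->
  order_lt n (fun x => D1 x + D2 x).
Proof.
elim: n D1 D2 => [|n IH] D1 D2; first by move=> /= z1 z2 x; rewrite z1 z2 addr0.
move=> /order_ltSE o1 /order_ltSE o2; apply/order_ltSE => e a ha.
rewrite (_ : supercomm _ _ _ _ =
  fun x => supercomm inv D1 e a x + supercomm inv D2 e a x); last first.
  by apply/funext => x; rewrite /supercomm iter_invD mulrDr opprD addrACA.
by apply: IH; [exact: o1|exact: o2].
Qed.

Lemma order_lt_sum n (T : Type) (s : seq T) (D : T -> A -> A) :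
  (forall t, order_lt n (D t)) -> order_lt n (fun x => \sum_(t <- s) D t x).
Proof.
move=> oD; elim: s => [|t s IH].
  by apply: order_lt_zero => x; rewrite big_nil.
rewrite (_ : (fun x => _) = fun x => D t x + \sum_(u <- s) D u x).
  exact: order_ltD.
by apply/funext => x; rewrite big_cons.
Qed.

Lemma order_lt_iconj n D e : order_lt n D -> order_lt n (iconj e D).
Proof.
elim: n D => [|n IH] D; first by move=> z x; rewrite /iconj z iter_inv0.
move=> /order_ltSE oD; apply/order_ltSE => e' a ha.
rewrite (_ : supercomm _ _ _ _ = iconj e (supercomm inv D e' (iter e inv a))).
  by apply: IH; apply: oD; apply: homogeneous_iter.
apply/funext => x; rewrite /supercomm /iconj iter_invB !iter_invM iter_invK.
by congr (_ - a * _); rewrite !(iter_invC e' e).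
Qed.

(** The Leibniz rule, with [iconj e D2] in the place of the usual sign. *)
Lemma supercomm_comp D1 D2 e a x : zmod_morphism D1 ->
  supercomm inv (fun x => D1 (D2 x)) e a x =
  D1 (supercomm inv D2 e a x) + supercomm inv D1 e a (iconj e D2 x).
Proof.
move=> add1; rewrite /supercomm /iconj add1 iter_invK addrA; congr (_ - _).
by rewrite subrK.
Qed.

(** Orders add: by the Leibniz rule, each supercommutator of a product lowers
    the order of one of the factors.  With the shifted index, two factors
    of orders at most k - 1 and l - 1 give the index k + l - 1, and the
    truncated predecessor is harmless, as a product with a zero factor is 0. *)
Lemma order_lt_comp k l D1 D2 : zmod_morphism D1 ->
  order_lt k D1 -> order_lt l D2 -> order_lt (k + l).-1 (fun x => D1 (D2 x)).
Proof.
elim: k l D1 D2 => [|k IHk] l D1 D2.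
  by move=> _ z1 _; apply: order_lt_zero => x; apply: z1.
elim: l D2 => [|l IHl] D2 add1 o1.
  move=> z2; apply: order_lt_zero => x; rewrite z2.
  by rewrite -[X in D1 X](subrr 0) add1 subrr.
move=> o2; rewrite addnS addSn -pred_Sn; apply/order_ltSE => e a ha.
rewrite (_ : supercomm _ _ _ _ = fun x => D1 (supercomm inv D2 e a x) +
    supercomm inv D1 e a (iconj e D2 x)); last first.
  by apply/funext => x; rewrite supercomm_comp.
have /order_ltSE o1' := o1; have /order_ltSE o2' := o2.
apply: order_ltD.
  by have := IHl _ add1 o1 (o2' e a ha); rewrite addSn.
have := IHk l.+1 _ (iconj e D2) (supercomm_additive e a add1) (o1' e a ha).
by rewrite addnS; apply; exact: order_lt_iconj.
Qed.

(** In a supercommutative superalgebra multiplications are the operators of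
    order 0.  The hypothesis expresses that [a] supercommutes with homogeneous
    elements without decomposing [a] into its even and odd parts. *)
Lemma order_lt_mul a :
  (forall e b, homogeneous inv e b -> a * b = b * iter e inv a) ->
  order_lt 1 (fun x => a * x).
Proof.
move=> ca; apply/order_ltSE => e b hb x.
by rewrite /supercomm iter_invM iter_invK !mulrA (ca e) // subrr.
Qed.

End SupercommutatorCalculus.

(** * Signs in the Grassmann algebra *)

Section GrassmannSigns.
Variables (R : realType) (q : nat).
Implicit Types (f g : grass R q) (I J K : {set 'I_q}).

Lemma ginvolK : involutive (@ginvol R q).
Proof.
by move=> f; apply/ffunP => I; rewrite !ffunE mulrA -exprD addnn -mul2n
  exprM sqrrN !expr1n mul1r.
Qed.

Lemma ginvolM : {morph @ginvol R q : f g / f * g}.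
Proof.
move=> f g; apply/ffunP => I; rewrite ffunE !grass_mulE mulr_sumr.
apply: eq_bigr => J; rewrite powersetE => JI; rewrite !ffunE.
rewrite -(cardsID J I) (finset.setIidPr JI) exprD; ring.
Qed.

Lemma ginvol1 : ginvol (1 : grass R q) = 1.
Proof.
apply/ffunP => I; rewrite !ffunE; case: eqP => [->|_]; last exact: mulr0.
by rewrite cards0 mul1r.
Qed.

(** Every pair in J x K is inverted in exactly one of the two orders. *)
Lemma inversions_swap J K : [disjoint J & K] ->
  (inversions J K + inversions K J = #|J| * #|K|)%N.
Proof.
move=> dJK; rewrite /inversions -cardsX.
rewrite -(card_imset [set jk : _ * _ | [&& jk.1 \in K, _ & _]] (can_inj swap_pairK)).
rewrite -cardsUI [X in (_ + X)%N]eq_card0 ?addn0; last first.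
  move=> -[a b]; rewrite !inE /=; apply/negP => /andP[/and3P[_ _ ba]].
  by case/imsetP => -[c d]; rewrite inE /= => /and3P[_ _ dc] [ad bc];
    move: ba; rewrite ad bc ltnNge (ltnW dc).
apply: eq_card => -[a b]; rewrite !inE /=.
rewrite (_ : _ \in (imset _ _) = [&& a \in J, b \in K & (a < b)%N]); last first.
  apply/imsetP/and3P => [[[c d]]|[aJ bK ab]].
    by rewrite inE /= => /and3P[? ? ?] [-> ->].
  by exists (b, a); rewrite ?inE /= ?aJ ?bK.
case aJ : (a \in J) => //=; case bK : (b \in K) => //=.
case: ltngtP => // /val_inj ab.
by move: (disjointFr dJK aJ); rewrite -ab bK.
Qed.

(** The two signs differ, so that the coefficient equals its opposite. *)
Lemma homogeneous_vanish e f K : homogeneous (@ginvol R q) e f ->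
  odd #|K| != e -> f K = 0.
Proof.
move=> /ffunP/(_ K); rewrite ffunE -signr_odd.
have -> : ((-1) ^+ e * f) K = (-1) ^+ e * f K.
  by case: e; rewrite ?expr0 ?expr1 ?mul1r // mulN1r ffunE mulN1r.
by case: e; case: (odd _) => //=; rewrite ?expr0 ?expr1 ?mul1r ?mulN1r;
  move=> /eqP h _; apply/eqP; move: h; rewrite ?eqNr ?[_ == - _]eq_sym ?eqNr.
Qed.

Lemma grass_supercommutative e f b : homogeneous (@ginvol R q) e b ->
  f * b = b * iter e (@ginvol R q) f.
Proof.
move=> hb; apply/ffunP => I; rewrite !grass_mulE.
(* exchange the factors: J and its complement in I swap their roles *)
rewrite [RHS](reindex_onto (fun J => I :\: J)%SET (fun J => I :\: J)%SET) /=; last first.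
  by move=> J; rewrite powersetE finset.setDDr finset.setDv finset.set0U => /finset.setIidPr.
apply: eq_big => J; rewrite !powersetE.
  rewrite finset.subsetDl /= finset.setDDr finset.setDv finset.set0U.
  by apply/idP/eqP => /finset.setIidPr.
move=> JI; have -> : (I :\: (I :\: J) = J)%SET.
  by rewrite finset.setDDr finset.setDv finset.set0U; apply/finset.setIidPr.
set K := (I :\: J)%SET.
have [oK|oK] := eqVneq (odd #|K|) e; last first.
  by rewrite (homogeneous_vanish hb oK) mul0r !mulr0.
have dJK : [disjoint J & K].
  rewrite -finset.setI_eq0 finset.setIDA finset.setIC -finset.setIDA.
  by rewrite finset.setDv finset.setI0.
have -> : iter e (@ginvol R q) f J = (-1) ^+ (#|J| * #|K|) * f J.
  by rewrite mulnC exprM -signr_odd oK; case: (e); rewrite /= ?ffunE // expr1n mul1r.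
rewrite -(inversions_swap dJK) exprD.
have : ((-1 : R) ^+ inversions K J) ^+ 2 = 1 by rewrite -exprM mulnC exprM sqrrN !expr1n.
move: ((-1 : R) ^+ inversions K J) => s s2.
rewrite (_ : _ * (_ * _) = s ^+ 2 * ((-1) ^+ inversions J K * (f J * b K))); first by ring.
by rewrite s2 mul1r.
Qed.

End GrassmannSigns.

Local Open Scope classical_set_scope.
Local Open Scope ring_scope.

(** * The superalgebra of superfunctions *)

Section SuperfunctionAlgebra.
Variables (R : realType) (p q : nat) (U : set 'rV[R]_p).
Local Notation SF := (superfun q U).
Implicit Types (F G : SF) (c : R) (x : 'rV[R]_p).

Lemma superfunD F G x : (F + G) x = F x + G x. Proof. by []. Qed.
Lemma superfunZ c F x : (c *: F) x = c *: F x. Proof. by []. Qed.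
Lemma superfunN F x : (- F) x = - F x. Proof. by []. Qed.
Lemma superfunM F G x : (F * G) x = F x * G x. Proof. by []. Qed.

Lemma superfun_sum (T : Type) (s : seq T) (P : pred T) (F : T -> SF) x :
  (\sum_(t <- s | P t) F t) x = \sum_(t <- s | P t) F t x.
Proof. by elim/big_rec2: _ => // t y G _ <-. Qed.

Lemma grass_scaleE q' c (f : grass R q') I : (c *: f) I = c * f I.
Proof. by rewrite [LHS]ffunE. Qed.

Lemma superfun_coefD F G x I : (F + G) x I = F x I + G x I.
Proof. by rewrite superfunD ffunE. Qed.

Lemma superfun_coefB F G x I : (F - G) x I = F x I - G x I.
Proof. by rewrite superfunD superfunN !ffunE. Qed.

Lemma superfun_coefZ c F x I : (c *: F) x I = c * F x I.
Proof. by rewrite superfunZ grass_scaleE. Qed.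

Lemma grass_scalerAl c (f g : grass R q) : c *: (f * g) = (c *: f) * g.
Proof.
apply/ffunP => I; rewrite grass_scaleE !grass_mulE mulr_sumr.
by apply: eq_bigr => J _; rewrite grass_scaleE; ring.
Qed.

Lemma grass_scalerAr c (f g : grass R q) : c *: (f * g) = f * (c *: g).
Proof.
apply/ffunP => I; rewrite grass_scaleE !grass_mulE mulr_sumr.
by apply: eq_bigr => J _; rewrite grass_scaleE; ring.
Qed.

Lemma sf_scalerAl c F G : c *: (F * G) = (c *: F) * G.
Proof. by apply: superfun_inj => x; exact: grass_scalerAl. Qed.

Lemma sf_scalerAr c F G : c *: (F * G) = F * (c *: G).
Proof. by apply: superfun_inj => x; exact: grass_scalerAr. Qed.

Lemma ginvolB : {morph @ginvol R q : f g / f - g}.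
Proof. by move=> f g; apply/ffunP => I; rewrite !ffunE mulrBr. Qed.

Lemma sf_invol_zmod_morphism : zmod_morphism (@sf_invol R p q U).
Proof. by move=> F G; apply: superfun_inj => x; exact: ginvolB. Qed.

HB.instance Definition _ :=
  GRing.isZmodMorphism.Build SF SF (@sf_invol R p q U) sf_invol_zmod_morphism.

Lemma sf_invol_monoid_morphism : GRing.monoid_morphism (@sf_invol R p q U).
Proof.
split=> [|F G]; apply: superfun_inj => x; last exact: ginvolM.
rewrite /= /cutoff; case: ifP => _; first exact: ginvol1.
by apply/ffunP => I; rewrite !ffunE mulr0.
Qed.

HB.instance Definition _ :=
  GRing.isMonoidMorphism.Build SF SF (@sf_invol R p q U) sf_invol_monoid_morphism.

Lemma sf_involK : involutive (@sf_invol R p q U).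
Proof. by move=> F; apply: superfun_inj => x; exact: ginvolK. Qed.

Lemma sf_involZ c F : sf_invol (c *: F) = c *: sf_invol F.
Proof.
apply: superfun_inj => x; apply/ffunP => I.
by rewrite /= !(ffunE, grass_scaleE) mulrCA.
Qed.

Lemma sf_invol_iterE (e : bool) F x :
  iter e (@sf_invol R p q U) F x = iter e (@ginvol R q) (F x).
Proof. by case: e. Qed.

Lemma sf_signE e F x : ((-1) ^+ (e : bool) * F) x = (-1) ^+ e * F x.
Proof. by case: e; rewrite ?expr0 ?expr1 ?mul1r ?mulN1r. Qed.

Lemma sf_supercommutative e F G : homogeneous (@sf_invol R p q U) e G ->
  F * G = G * iter e (@sf_invol R p q U) F.
Proof.
move=> hG; apply: superfun_inj => x; rewrite !superfunM sf_invol_iterE.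
apply: grass_supercommutative.
by have := congr1 (fun H : SF => H x) hG; rewrite sf_signE.
Qed.

Lemma sf_order_mul F : order_lt (@sf_invol R p q U) 1 (fun G => F * G).
Proof.
by apply: order_lt_mul => [|e G]; [exact: sf_involK|exact: sf_supercommutative].
Qed.

Lemma smooth_at_pderivable (f : 'rV[R]_p -> R) i x :
  smooth_at f x -> pderivable i f x.
Proof. by move=> /(_ 1%N)[_ /(_ i)[dfx _]]; exact: (nbhs_singleton dfx). Qed.

(** Additivity of the partial derivatives uses that the coefficients are
    differentiable, hence the smoothness built into superfunctions. *)
Lemma sf_deriv_linear a : linear (@sf_deriv R p q U a).
Proof.
move=> c F G; apply: superfun_inj => x; rewrite [RHS]superfunD superfunZ /= /cutoff.
case: asboolP => Ux; last by rewrite scaler0 addr0.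
have dF I i := @smooth_at_pderivable _ i x ((superfunP F).1 x Ux I).
have dG I i := @smooth_at_pderivable _ i x ((superfunP G).1 x Ux I).
apply/ffunP => I; rewrite [RHS]ffunE grass_scaleE.
case: a => [i|j] /=; rewrite !ffunE; last first.
  by case: ifP => _; rewrite ?mulr0 ?addr0 // mulrDr; congr (_ + _); exact: mulrCA.
rewrite (_ : (fun y => _) = c *: (fun y => F y I) + (fun y => G y I)); last first.
  by apply/funext => y; rewrite !ffunE.
rewrite /partial deriveD; [|exact: derivableZ (dF I i)|exact: dG I i].
by rewrite deriveZ //; exact: dF I i.
Qed.

End SuperfunctionAlgebra.

(** * The superalgebra of densities *)

Section LinearMaps.
Variables (R : pzRingType) (V W : lmodType R) (L : V -> W).
Hypothesis linL : linear L.

Lemma linear_zmod_morphism : zmod_morphism L.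
Proof. by move=> x y; rewrite addrC -scaleN1r linL scaleN1r addrC. Qed.

Lemma linear_zero : L 0 = 0.
Proof. by rewrite -[X in L X](subrr 0) linear_zmod_morphism subrr. Qed.

Lemma linear_scale c x : L (c *: x) = c *: L x.
Proof. by have := linL c x 0; rewrite !addr0 linear_zero addr0. Qed.

Lemma linear_add x y : L (x + y) = L x + L y.
Proof. by have := linL 1 x y; rewrite !scale1r. Qed.

Lemma linear_big (T : Type) (s : seq T) (x : T -> V) :
  L (\sum_(t <- s) x t) = \sum_(t <- s) L (x t).
Proof. exact: (big_morph L linear_add linear_zero). Qed.

End LinearMaps.

Section DensityAlgebra.
Variables (R : realType) (p q : nat) (U : set 'rV[R]_p).
Local Notation SF := (superfun q U).
Local Notation DS := (densities q U).
Local Notation sfdiff := (diffop (range (@sf_deriv R p q U))).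
Local Notation densdiff :=
  (diffop (range (@dderiv R p q U) `|` [set @ddt R p q U])).
Local Notation sforder := (order_lt (@sf_invol R p q U)).
Local Notation densorder := (order_lt (@dinvol R p q U)).
Implicit Types (F G : SF) (f g : DS) (c u v w : R).

Lemma densitiesD f g w : (f + g) w = f w + g w. Proof. by []. Qed.
Lemma densitiesZ c f w : (c *: f) w = c *: f w. Proof. by []. Qed.

Lemma densities_sum (T : Type) (s : seq T) (f : T -> DS) w :
  (\sum_(t <- s) f t) w = \sum_(t <- s) f t w.
Proof. by elim/big_rec2: _ => // t y g _ <-. Qed.

Lemma dmonoE w F u : dmono w F u = if u == w then F else 0.
Proof. by []. Qed.

Lemma dmono_id w F : dmono w F w = F.
Proof. by rewrite dmonoE eqxx. Qed.

Lemma dmono_linear w : linear (@dmono R p q U w).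
Proof.
move=> c F G; apply: densities_inj => u.
rewrite densitiesD densitiesZ !dmonoE; case: eqP => // _.
by rewrite scaler0 addr0.
Qed.

Lemma densities_seq f : exists2 s, uniq s & forall w, w \notin s -> f w = 0.
Proof.
have [s us fs] := finite_weights_seq (densitiesP f); exists s => // w /negP ws.
by apply/eqP/negPn/negP => /fs.
Qed.

Lemma weights_subset (s : seq R) f :
  (forall w, w \notin s -> f w = 0) -> weights f `<=` [set` s].
Proof.
move=> fs w /negP fw; apply/negPn/negP => /fs fw0.
by apply: fw; rewrite fw0.
Qed.

Lemma densities_expand (s : seq R) f : uniq s ->
  (forall w, w \notin s -> f w = 0) -> f = \sum_(w <- s) dmono w (f w).
Proof.
move=> us fs; apply: densities_inj => v; rewrite densities_sum.
have [vs|vs] := boolP (v \in s); last first.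
  rewrite (fs _ vs) big_seq big1 // => w ws; rewrite dmonoE.
  by case: eqP => // vw; rewrite vw ws in vs.
rewrite (bigD1_seq v) // dmono_id big1 => [|w wv]; first by rewrite /= addr0.
by rewrite dmonoE eq_sym (negbTE wv).
Qed.

Lemma densities_mulE (s : seq R) f g w : uniq s ->
  (forall u, u \notin s -> f u = 0) ->
  (f * g) w = \sum_(u <- s) f u * g (w - u).
Proof.
by move=> us fs; exact: (@raw_dmulE _ _ _ _ s f g w us (weights_subset fs)).
Qed.

Lemma dmono_mulE u F f w : (dmono u F * f) w = F * f (w - u).
Proof.
rewrite (@densities_mulE [:: u]) // ?big_seq1 ?dmono_id // => v.
by rewrite inE dmonoE => /negbTE ->.
Qed.

Lemma dmono_mul u v F G : dmono u F * dmono v G = dmono (u + v) (F * G).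
Proof.
apply: densities_inj => w; rewrite dmono_mulE !dmonoE subr_eq [v + u]addrC.
by case: eqP => // _; rewrite mulr0.
Qed.

Lemma dens_scalerAr c f g : c *: (f * g) = f * (c *: g).
Proof.
apply: densities_inj => w; have [s us fs] := densities_seq f.
rewrite densitiesZ !(densities_mulE _ _ us fs) scaler_sumr.
by apply: eq_bigr => u _; rewrite sf_scalerAr.
Qed.

Lemma dens_mul_linear f : linear (fun g => f * g).
Proof. by move=> c g h; rewrite mulrDr dens_scalerAr. Qed.

Lemma dinvolE f w : dinvol f w = sf_invol (f w). Proof. by []. Qed.

Lemma dinvol_mono w F : dinvol (dmono w F) = dmono w (sf_invol F).
Proof.
by apply: densities_inj => u; rewrite dinvolE !dmonoE; case: eqP => //; rewrite rmorph0.
Qed.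

Lemma dinvol_zmod_morphism : zmod_morphism (@dinvol R p q U).
Proof. by move=> f g; apply: densities_inj => w; exact: rmorphB. Qed.

HB.instance Definition _ :=
  GRing.isZmodMorphism.Build DS DS (@dinvol R p q U) dinvol_zmod_morphism.

Lemma dinvol_monoid_morphism : GRing.monoid_morphism (@dinvol R p q U).
Proof.
split=> [|f g]; first by rewrite [1](_ : _ = dmono 0 1) // dinvol_mono rmorph1.
apply: densities_inj => w; have [s us fs] := densities_seq f.
rewrite (@densities_mulE s) // => [|u us']; last by rewrite dinvolE fs // rmorph0.
rewrite dinvolE (@densities_mulE s) // rmorph_sum.
by apply: eq_bigr => u _; rewrite rmorphM.
Qed.

HB.instance Definition _ :=
  GRing.isMonoidMorphism.Build DS DS (@dinvol R p q U) dinvol_monoid_morphism.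

Lemma dinvolK : involutive (@dinvol R p q U).
Proof. by move=> f; apply: densities_inj => w; exact: sf_involK. Qed.

Lemma dinvol_iterE (e : bool) f w :
  iter e (@dinvol R p q U) f w = iter e (@sf_invol R p q U) (f w).
Proof. by case: e. Qed.

Lemma dens_signE (e : bool) f w : ((-1) ^+ e * f) w = (-1) ^+ e * f w.
Proof. by case: e; rewrite ?expr0 ?expr1 ?mul1r ?mulN1r. Qed.

Lemma dens_homogeneousP e f : homogeneous (@dinvol R p q U) e f <->
  forall w, homogeneous (@sf_invol R p q U) e (f w).
Proof.
split=> [hf w|hf].
  by have := congr1 (fun g : DS => g w) hf; rewrite dens_signE.
by apply: densities_inj => w; rewrite dens_signE; exact: hf.
Qed.

(** Reindexing the convolution product by u |-> w - u reduces the claim to the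
    coefficients; the range of summation must contain both the weights of [f]
    and the reflected weights of [g]. *)
Lemma dens_supercommutative e f g : homogeneous (@dinvol R p q U) e g ->
  f * g = g * iter e (@dinvol R p q U) f.
Proof.
move=> /dens_homogeneousP hg; apply: densities_inj => w.
have [s us fs] := densities_seq f; have [t ut gt] := densities_seq g.
pose r := undup (s ++ [seq w - v | v <- t]).
rewrite (@densities_mulE r) ?undup_uniq //; last first.
  by move=> u; rewrite mem_undup mem_cat negb_or => /andP[/fs].
rewrite [RHS](@densities_mulE [seq w - u | u <- r]).
- rewrite big_map; apply: eq_bigr => u _.
  by rewrite dinvol_iterE subKr; exact: sf_supercommutative.
- by rewrite map_inj_uniq ?undup_uniq // => x y /addrI /oppr_inj.
- move=> v vr; apply: gt; apply: contra vr => vt; apply/mapP; exists (w - v).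
    by rewrite mem_undup mem_cat; apply/orP; right; apply/mapP; exists v.
  by rewrite subKr.
Qed.

Lemma dens_order_mul f : densorder 1 (fun g => f * g).
Proof.
by apply: order_lt_mul => [|e g]; [exact: dinvolK|exact: dens_supercommutative].
Qed.

Lemma dderiv_linear a : linear (@dderiv R p q U a).
Proof. by move=> c f g; apply: densities_inj => w; exact: sf_deriv_linear. Qed.

Lemma ddtE f w : ddt f w = (w + 1) *: f (w + 1).
Proof. by []. Qed.

Lemma ddt_linear : linear (@ddt R p q U).
Proof.
move=> c f g; apply: densities_inj => w.
rewrite densitiesD densitiesZ !ddtE densitiesD densitiesZ scalerDr !scalerA.
by rewrite mulrC.
Qed.

Lemma sf_diffop_linear (D : SF -> SF) : sfdiff D -> linear D.
Proof.
elim=> {D} [F|D [a _ <-]|D1 D2 _ l1 _ l2|D1 D2 _ l1 _ l2] c x y.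
- by rewrite mulrDr sf_scalerAr.
- exact: sf_deriv_linear.
- by rewrite l1 l2 scalerDr addrACA.
- by rewrite l2 l1.
Qed.

Lemma dens_diffop_linear (D : DS -> DS) :
  densdiff D -> linear D.
Proof.
elim=> {D} [f|D [[a _ <-]|->]|D1 D2 _ l1 _ l2|D1 D2 _ l1 _ l2] c x y.
- exact: dens_mul_linear.
- exact: dderiv_linear.
- exact: ddt_linear.
- by rewrite l1 l2 scalerDr addrACA.
- by rewrite l2 l1.
Qed.

(** * From pencils to operators *)

(** The lift lets an operator in x act on each coefficient. *)
Lemma diffop_lift (D : SF -> SF) : sfdiff D ->
  exists2 E : DS -> DS,
    densdiff E &
    forall f w, E f w = D (f w).
Proof.
elim=> {D} [F|D [a _ <-]|D1 D2 _ [E1 d1 e1] _ [E2 d2 e2]|D1 D2 _ [E1 d1 e1] _ [E2 d2 e2]].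
- exists (fun f => dmono 0 F * f); first exact: diffop_mul.
  by move=> f w; rewrite dmono_mulE subr0.
- by exists (@dderiv R p q U a) => //; apply: diffop_deriv; left; exists a.
- exists (fun f => E1 f + E2 f); first exact: diffop_add.
  by move=> f w; rewrite densitiesD e1 e2.
- exists (fun f => E1 (E2 f)); first exact: diffop_comp.
  by move=> f w; rewrite e1 e2.
Qed.

(** The supercommutator of the lift [E] with a density [a] is a sum over the
    weights u of [a]: the lift of the supercommutator of [D] with [a u],
    followed by multiplication by t^u, which has order 0. *)
Lemma order_lift n (D : SF -> SF) (E : DS -> DS) : linear D ->
  (forall f w, E f w = D (f w)) ->
  sforder n D -> densorder n E.
Proof.
move=> /linear_zmod_morphism; elim: n D E => [|n IH] D E addD ED.
  by move=> D0 f; apply: densities_inj => w; rewrite ED D0.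
move=> /order_ltSE oD; apply/order_ltSE => e a ha.
have [s us as_] := densities_seq a.
pose C u := supercomm (@sf_invol R p q U) D e (a u).
have addC u : zmod_morphism (C u) by exact: supercomm_additive.
have C0 u : C u 0 = 0 by rewrite -[X in C u X](subrr 0) addC subrr.
pose lift u f : DS := mk_densities (finite_weights_map f (C0 u)).
have -> : supercomm (@dinvol R p q U) E e a =
    fun f => \sum_(u <- s) dmono u 1 * lift u f.
  apply/funext => f; apply: densities_inj => w; rewrite densities_sum.
  rewrite [LHS](_ : _ =
    D ((a * f) w) - (a * iter e (@dinvol R p q U) (E (iter e (@dinvol R p q U) f))) w);
    last by rewrite -ED.
  rewrite !(densities_mulE _ _ us as_).
  have -> (g : R -> SF) : D (\sum_(u <- s) g u) = \sum_(u <- s) D (g u).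
    have D0 : D 0 = 0 by rewrite -[X in D X](subrr 0) addD subrr.
    have DD : {morph D : F G / F + G}.
      by move=> F G; rewrite -[G in LHS]opprK addD -[- G]sub0r addD D0 sub0r opprK.
    exact: (big_morph D DD D0).
  rewrite -sumrB; apply: eq_bigr => u _; rewrite dmono_mulE mul1r.
  by rewrite dinvol_iterE ED dinvol_iterE.
apply: order_lt_sum => u; apply: (order_lt_comp dinvolK (k := 1) (l := n)).
- by apply: linear_zmod_morphism; exact: dens_mul_linear.
- exact: dens_order_mul.
- by apply: (IH (C u)) => //; apply: oD; exact: (dens_homogeneousP e a).1.
Qed.

(** t d/dt, which is multiplication by the weight. *)
Definition euler f : DS := dmono 1 1 * ddt f.

Lemma eulerE f w : euler f w = w *: f w.
Proof. by rewrite dmono_mulE mul1r ddtE subrK. Qed.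

Lemma euler_diffop : densdiff euler.
Proof.
apply: (diffop_comp (D1 := fun f => dmono 1 1 * f)); first exact: diffop_mul.
by apply: diffop_deriv; right.
Qed.

Lemma euler_mul f g : euler (f * g) = euler f * g + f * euler g.
Proof.
apply: densities_inj => w; have [s us fs] := densities_seq f.
rewrite eulerE densitiesD !(@densities_mulE s) // => [|u /fs fu]; last first.
  by rewrite eulerE fu scaler0.
rewrite scaler_sumr.
transitivity (\sum_(u <- s) (u *: f u * g (w - u) + f u * ((w - u) *: g (w - u)))).
  apply: eq_bigr => u _.
  by rewrite -sf_scalerAl -sf_scalerAr -scalerDl [u + _]addrC subrK.
by rewrite big_split; congr (_ + _); apply: eq_bigr => u _; rewrite eulerE.
Qed.

(** The Euler operator is an even derivation, so that its supercommutator with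
    [a] is multiplication by [euler a]. *)
Lemma euler_order : densorder 2 euler.
Proof.
apply/order_ltSE => e a _.
rewrite (_ : supercomm _ _ _ _ = fun f => euler a * f); first exact: dens_order_mul.
apply/funext => f; rewrite /supercomm euler_mul.
suff -> : iter e (@dinvol R p q U) (euler (iter e (@dinvol R p q U) f)) = euler f.
  by rewrite addrK.
apply: densities_inj => w; rewrite dinvol_iterE !eulerE dinvol_iterE.
by case: e => //=; rewrite sf_involZ sf_involK.
Qed.

(** [D] is t^lam times D0 + A (t d/dt) + B (t d/dt)^2, since both sides are
    linear and agree on monomials; each of the three summands has order
    at most 2. *)
Lemma quadratic_pencil_order lam (D0 A B : SF -> SF) (D : DS -> DS) :
  sf_diffop_le 2 D0 -> sf_diffop_le 1 A -> sf_diffop_le 0 B -> linear D ->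
  (forall w F, D (dmono w F) = dmono (w + lam) (D0 F + w *: A F + w ^+ 2 *: B F)) ->
  dens_diffop_le 2 D.
Proof.
move=> [dD0 oD0] [dA oA] [dB oB] linD DE.
have [[l0 lA] lB] := (sf_diffop_linear dD0, sf_diffop_linear dA, sf_diffop_linear dB).
have [[E0 d0 e0] [EA dEA eA]] := (diffop_lift dD0, diffop_lift dA).
have [EB dEB eB] := diffop_lift dB.
pose S f := E0 f + EA (euler f) + EB (euler (euler f)).
have SE f w : S f w = D0 (f w) + w *: A (f w) + w ^+ 2 *: B (f w).
  rewrite !densitiesD e0 eA eB !eulerE (linear_scale lA) !(linear_scale lB).
  by rewrite scalerA -expr2.
have dS : densdiff S.
  have dE := euler_diffop.
  apply: diffop_add; last exact: diffop_comp dEB (diffop_comp dE dE).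
  by apply: diffop_add => //; exact: diffop_comp dEA dE.
have -> : D = fun f => dmono lam 1 * S f.
  apply/funext => f; have [s us fs] := densities_seq f.
  rewrite (densities_expand us fs) (linear_big linD).
  have linS : linear (fun f => dmono lam 1 * S f).
    by move=> c g h; rewrite (dens_diffop_linear dS) dens_mul_linear.
  rewrite (linear_big linS); apply: eq_bigr => w _; rewrite DE.
  apply: densities_inj => v; rewrite dmono_mulE mul1r SE !dmonoE subr_eq.
  case: eqP => [->|_]; first by rewrite addrK.
  by rewrite (linear_zero l0) (linear_zero lA) (linear_zero lB) !scaler0 !addr0.
split; first by apply: (diffop_comp (D1 := fun f => dmono lam 1 * f)) dS; exact: diffop_mul.
have oE := euler_order.
have linE := linear_zmod_morphism (dens_diffop_linear _).
have oS : densorder 3 S.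
  apply: order_ltD; first apply: order_ltD.
  - exact: (@order_lift 3 _ _ l0 e0 oD0).
  - apply: (order_lt_comp dinvolK (k := 2) (l := 2)) oE; first exact: linE.
    exact: (@order_lift 2 _ _ lA eA oA).
  - apply: (order_lt_comp dinvolK (k := 1) (l := 3)); first exact: linE.
      exact: (@order_lift 1 _ _ lB eB oB).
    exact: (order_lt_comp dinvolK (linE _ euler_diffop) oE oE).
apply: (order_lt_comp dinvolK (k := 1) (l := 3)) oS; last exact: dens_order_mul.
by apply: linear_zmod_morphism; exact: dens_mul_linear.
Qed.

End DensityAlgebra.

(** * Polynomials with vanishing third differences *)

Section ThirdDifference.
Variable R : realFieldType.
Implicit Types (r : {poly R}) (w : R).

Lemma poly_nat_roots r : (forall n : nat, r.[n%:R] = 0) -> r = 0.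
Proof.
move=> r0; apply: (@roots_geq_poly_eq0 _ _ [seq n%:R | n <- iota 0 (size r)]).
- by apply/allP => _ /mapP[n _ ->]; apply/eqP.
- by rewrite map_inj_uniq ?iota_uniq // => m n /eqP; rewrite eqr_nat => /eqP.
- by rewrite size_map size_iota.
Qed.

Definition fdiff (f : R -> R) w := f (w + 1) - f w.

(** Subtract the quadratic polynomial that interpolates [r] at 0, 1, 2.  The
    difference satisfies a recurrence of depth 3 with three zero initial
    values, so that it vanishes at all natural numbers. *)
Lemma poly_third_difference r w :
  (forall v, fdiff (fdiff (fdiff (horner r))) v = 0) ->
  r.[w] = r.[0] + w * (r.[1] - r.[0] - 2^-1 * (r.[1 + 1] - r.[1] - (r.[1] - r.[0])))
    + w ^+ 2 * (2^-1 * (r.[1 + 1] - r.[1] - (r.[1] - r.[0]))).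
Proof.
move=> r3; pose b := 2^-1 * (r.[1 + 1] - r.[1] - (r.[1] - r.[0])).
rewrite -/b; pose a := r.[1] - r.[0] - b; rewrite -/a.
pose g := r - (r.[0]%:P + a *: 'X + b *: 'X^2).
have gE v : g.[v] = r.[v] - (r.[0] + a * v + b * v ^+ 2) by rewrite /g !hornerE.
have g3 v : g.[v + 1 + 1 + 1] = 3 * g.[v + 1 + 1] - 3 * g.[v + 1] + g.[v].
  by have := r3 v; rewrite /fdiff !gE; lra.
suff /(congr1 (horner^~ w)) : g = 0 by rewrite gE horner0; lra.
apply: poly_nat_roots => n.
suff [] : [/\ g.[n%:R] = 0, g.[n%:R + 1] = 0 & g.[n%:R + 1 + 1] = 0] by [].
elim: n => [|n [g0 g1 g2]].
  by rewrite !add0r !gE; split; rewrite /a /b; lra.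
by rewrite -natr1 g3 g0 g1 g2; split=> //; lra.
Qed.

End ThirdDifference.

(** * From operators to pencils *)

Section OperatorToPencil.
Variables (R : realType) (p q : nat) (U : set 'rV[R]_p).
Local Notation SF := (superfun q U).
Local Notation DS := (densities q U).
Local Notation sfdiff := (diffop (range (@sf_deriv R p q U))).
Local Notation densdiff :=
  (diffop (range (@dderiv R p q U) `|` [set @ddt R p q U])).
Local Notation sforder := (order_lt (@sf_invol R p q U)).
Local Notation densorder := (order_lt (@dinvol R p q U)).
Implicit Types (F G : SF) (f g : DS) (c u v w lam : R).

Definition sf_scalar c : SF := c *: (1 : SF).

Lemma sf_scale_mul c F : c *: F = sf_scalar c * F.
Proof. by rewrite -sf_scalerAl mul1r. Qed.

Lemma sf_diffop_scale c (D : SF -> SF) : sfdiff D -> sfdiff (fun F => c *: D F).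
Proof.
move=> dD; have -> : (fun F => c *: D F) = fun F => sf_scalar c * D F.
  by apply/funext => F; exact: sf_scale_mul.
by apply: (diffop_comp (D1 := fun F => sf_scalar c * F)) dD; exact: diffop_mul.
Qed.

Lemma sf_diffopB (D1 D2 : SF -> SF) : sfdiff D1 -> sfdiff D2 ->
  sfdiff (fun F => D1 F - D2 F).
Proof.
move=> d1 d2; have -> : (fun F => D1 F - D2 F) = fun F => D1 F + (-1) *: D2 F.
  by apply/funext => F; rewrite scaleN1r.
by apply: diffop_add => //; exact: sf_diffop_scale.
Qed.

Lemma sf_diffop_sum (I : Type) (s : seq I) (P : pred I) (D : I -> SF -> SF) :
  (forall i, sfdiff (D i)) -> sfdiff (fun F => \sum_(i <- s | P i) D i F).
Proof.
move=> dD; elim: s => [|i s IH].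
  have -> : (fun F => \sum_(i <- [::] | P i) D i F) = fun F => 0 * F.
    by apply/funext => F; rewrite big_nil mul0r.
  exact: diffop_mul.
have -> : (fun F => \sum_(j <- i :: s | P j) D j F) =
    fun F => (P i)%:R *: D i F + \sum_(j <- s | P j) D j F.
  apply/funext => F; rewrite big_cons; case: (P i); first by rewrite scale1r.
  by rewrite scale0r add0r.
by apply: diffop_add => //; exact: sf_diffop_scale.
Qed.

Lemma sf_order_scale n c (D : SF -> SF) :
  sforder n D ->
  sforder n (fun F => c *: D F).
Proof.
move=> oD; have -> : (fun F => c *: D F) = fun F => sf_scalar c * D F.
  by apply/funext => F; exact: sf_scale_mul.
have addM : zmod_morphism (fun F : SF => sf_scalar c * F) by move=> F G; exact: mulrBr.
exact: (order_lt_comp (@sf_involK R p q U) addM (sf_order_mul (sf_scalar c)) oD).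
Qed.

Lemma sf_orderB n (D1 D2 : SF -> SF) :
  sforder n D1 -> sforder n D2 ->
  sforder n (fun F => D1 F - D2 F).
Proof.
move=> o1 o2; have -> : (fun F => D1 F - D2 F) = fun F => D1 F + (-1) *: D2 F.
  by apply/funext => F; rewrite scaleN1r.
by apply: order_ltD => //; exact: sf_order_scale.
Qed.

(** By induction on the generation of [D].  Multiplication by a density gives
    one term per weight, d/dt gives the factor w, and composition shifts the
    argument of the polynomials of the outer operator by the weights of the
    inner one. *)
Lemma dens_diffop_polynomial (D : DS -> DS) : densdiff D ->
  exists (I : finType) (r : I -> {poly R}) (u : I -> R) (C : I -> SF -> SF),
    (forall i, sfdiff (C i)) /\
    forall w F, D (dmono w F) = \sum_i (r i).[w] *: dmono (w + u i) (C i F).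
Proof.
elim=> {D} [f|D [[a _ <-]|->]
  |D1 D2 _ [I1 [r1 [u1 [C1 [d1 e1]]]]] _ [I2 [r2 [u2 [C2 [d2 e2]]]]]
  |D1 D2 dD1 [I1 [r1 [u1 [C1 [d1 e1]]]]] _ [I2 [r2 [u2 [C2 [d2 e2]]]]]].
- have [s us fs] := densities_seq f.
  exists 'I_(size s), (fun=> 1), (tnth (in_tuple s)),
    (fun i G => f (tnth (in_tuple s) i) * G); split=> [i|w F]; first exact: diffop_mul.
  rewrite {1}(densities_expand us fs) mulr_suml (big_tnth _ _ s).
  by apply: eq_bigr => i _; rewrite hornerC scale1r dmono_mul addrC.
- exists unit, (fun=> 1), (fun=> 0), (fun=> @sf_deriv R p q U a).
  split=> [_|w F]; first by apply: diffop_deriv; exists a.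
  rewrite big_const card_unit /= addr0 hornerC scale1r addr0.
  apply: densities_inj => v; rewrite [LHS]/= dmonoE; case: eqP => // _.
  exact: sf_deriv0.
- exists unit, (fun=> 'X), (fun=> -1), (fun=> fun F => 1 * F).
  split=> [_|w F]; first exact: diffop_mul.
  rewrite big_const card_unit /= addr0 hornerX mul1r.
  apply: densities_inj => v; rewrite ddtE densitiesZ !dmonoE eq_sym -subr_eq eq_sym.
  case: eqP => [->|_]; last by rewrite !scaler0.
  by rewrite subrK.
- exists (I1 + I2)%type,
    (fun i => match i with inl j => r1 j | inr j => r2 j end),
    (fun i => match i with inl j => u1 j | inr j => u2 j end),
    (fun i => match i with inl j => C1 j | inr j => C2 j end).
  by split=> [[]|w F] //; rewrite big_sumType /= e1 e2.
- exists (I2 * I1)%type, (fun i => r2 i.1 * (r1 i.2 \Po ('X + (u2 i.1)%:P))),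
    (fun i => u2 i.1 + u1 i.2), (fun i F => C1 i.2 (C2 i.1 F)).
  split=> [i|w F]; first exact: diffop_comp.
  have lD1 := dens_diffop_linear dD1.
  rewrite e2 (linear_big lD1) -(pair_big xpredT xpredT (fun j i =>
    (r2 j * (r1 i \Po ('X + (u2 j)%:P))).[w] *:
      dmono (w + (u2 j + u1 i)) (C1 i (C2 j F)))) /=.
  apply: eq_bigr => j _; rewrite (linear_scale lD1) e1 scaler_sumr.
  by apply: eq_bigr => i _; rewrite scalerA addrA hornerM horner_comp !hornerE.
Qed.

(** Multiplications by densities of weight 0 compute the supercommutators of
    [P w]. *)
Lemma order_coefficient n lam (D : DS -> DS) (P : R -> SF -> SF) w :
  densorder n D ->
  (forall w F, D (dmono w F) = dmono (w + lam) (P w F)) ->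
  sforder n (P w).
Proof.
elim: n D P => [|n IH] D P.
  by move=> D0 DP F; rewrite -(dmono_id (w + lam) (P w F)) -DP D0.
move=> /order_ltSE oD DP; apply/order_ltSE => e a ha.
have h0a : homogeneous (@dinvol R p q U) e (dmono 0 a).
  apply/dens_homogeneousP => v; rewrite dmonoE; case: eqP => // _.
  by rewrite /homogeneous mulr0 rmorph0.
apply: (IH _ (fun w => supercomm (@sf_invol R p q U) (P w) e a) (oD e _ h0a)).
move=> v F; rewrite /supercomm dmono_mul add0r.
have iterE u G : iter e (@dinvol R p q U) (dmono u G) =
    dmono u (iter e (@sf_invol R p q U) G).
  by case: (e) => //=; rewrite dinvol_mono.
rewrite iterE !DP iterE dmono_mul add0r.
by rewrite -(linear_zmod_morphism (@dmono_linear R p q U (v + lam))).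
Qed.

(** Multiplication by t shifts the weight, so that its supercommutator with
    [D] is the difference operator on pencils. *)
Lemma supercomm_dmono1 lam (D : DS -> DS) (P : R -> SF -> SF) w F :
  (forall w F, D (dmono w F) = dmono (w + lam) (P w F)) ->
  supercomm (@dinvol R p q U) D false (dmono 1 1) (dmono w F) =
  dmono (w + (lam + 1)) (P (w + 1) F - P w F).
Proof.
move=> DP; rewrite /supercomm /= dmono_mul !DP dmono_mul !mul1r.
rewrite [in RHS](linear_zmod_morphism (@dmono_linear R p q U _)).
by congr (dmono _ (P _ F) - dmono _ _); ring.
Qed.

Lemma homogeneous_dmono1 : homogeneous (@dinvol R p q U) false (dmono 1 1).
Proof. by rewrite /homogeneous dinvol_mono rmorph1 expr0 mul1r. Qed.

(** The coefficients are read off from the differences of [P] at the weight 0: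
    the second one is 2 B and the first one is A + B. *)
Lemma dens_diffop_quadratic lam (D : DS -> DS) (P : R -> SF -> SF) :
  dens_diffop_le 2 D ->
  (forall w F, D (dmono w F) = dmono (w + lam) (P w F)) ->
  exists D0 A B : SF -> SF,
    [/\ sf_diffop_le 2 D0, sf_diffop_le 1 A, sf_diffop_le 0 B &
        forall w F, P w F = D0 F + w *: A F + w ^+ 2 *: B F].
Proof.
move=> [dD oD] DP.
have [I [r [u [C [dC DE]]]]] := dens_diffop_polynomial dD.
have PE w F : P w F = \sum_(i | u i == lam) (r i).[w] *: C i F.
  rewrite -(dmono_id (w + lam) (P w F)) -DP DE densities_sum [RHS]big_mkcond.
  apply: eq_bigr => i _; rewrite densitiesZ dmonoE (inj_eq (addrI w)) eq_sym.
  by case: eqP => // _; rewrite scaler0.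
have dP w : sfdiff (P w).
  have -> : P w = fun F => \sum_(i | u i == lam) (r i).[w] *: C i F.
    by apply/funext => F; exact: PE.
  by apply: sf_diffop_sum => i; exact: sf_diffop_scale.
pose ad D := supercomm (@dinvol R p q U) D false (dmono 1 1).
pose dif (P : R -> SF -> SF) w F := P (w + 1) F - P w F.
(* each supercommutator with t also raises the weight of the operator by 1 *)
have DP1 w F : ad D (dmono w F) = dmono (w + (lam + 1)) (dif P w F).
  exact: supercomm_dmono1.
have DP2 w F : ad (ad D) (dmono w F) = dmono (w + (lam + 1 + 1)) (dif (dif P) w F).
  exact: supercomm_dmono1.
have DP3 w F : ad (ad (ad D)) (dmono w F) =
    dmono (w + (lam + 1 + 1 + 1)) (dif (dif (dif P)) w F).
  exact: supercomm_dmono1.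
have oD1 : densorder 2 (ad D).
  exact: oD homogeneous_dmono1.
have oD2 : densorder 1 (ad (ad D)).
  exact: oD1 homogeneous_dmono1.
have oD3 : densorder 0 (ad (ad (ad D))).
  exact: oD2 homogeneous_dmono1.
have dif3 w F : dif (dif (dif P)) w F = 0.
  by rewrite -(dmono_id (w + (lam + 1 + 1 + 1)) (dif _ w F)) -DP3 oD3.
pose B F := 2^-1 *: dif (dif P) 0 F.
pose A F := dif P 0 F - B F.
have ddif : sfdiff (dif P 0) by apply: sf_diffopB.
have dB : sfdiff B.
  by apply: sf_diffop_scale; apply: sf_diffopB; apply: sf_diffopB.
have oB : sforder 1 B.
  by apply: sf_order_scale; exact: order_coefficient oD2 DP2.
exists (P 0), A, B; split.
- by split=> //; exact: (order_coefficient (n := 3) 0 oD DP).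
- split; first exact: sf_diffopB.
  apply: (sf_orderB (n := 2)); last exact: order_ltS.
  exact: order_coefficient oD1 DP1.
- by [].
move=> w F; apply: superfun_inj => x; apply/ffunP => J.
(* fix F, x and J: the coefficient of P w F is a real polynomial in w *)
pose t := \sum_(i | u i == lam) (C i F x J) *: r i.
have tE v : (P v F) x J = t.[v].
  rewrite PE superfun_sum horner_sum sum_ffunE; apply: eq_bigr => i _.
  by rewrite superfun_coefZ hornerZ mulrC.
have t3 v : fdiff (fdiff (fdiff (horner t))) v = 0.
  have := congr1 (fun G : SF => G x J) (dif3 v F).
  by rewrite /dif !superfun_coefB !tE => h; rewrite /fdiff h; exact: ffunE.
have := poly_third_difference w t3; rewrite -!tE => ->.
rewrite /A /B /dif !(superfun_coefB, superfun_coefD, superfun_coefZ).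
by rewrite !add0r.
Qed.

End OperatorToPencil.

(** * Densities on a supermanifold *)

Section DensitiesOnSupermanifold.
Variables (R : realType) (p q : nat) (M : supermanifold R p q).
Implicit Types (i j : sm_chart M) (w lam : R).

Lemma sm_pullback_linear i j :
  linear (@sm_pullback R p q M i j).
Proof.
have oW : open (@sm_overlap R p q M i j) by apply: openI; exact: sm_dom_open.
move=> c F G; rewrite /sm_pullback.
have := @sm_trans_linear R p q M i j _ oW (@subset_refl _ _) c.
move=> <-; congr (sm_trans i _).
apply: superfun_inj => x; rewrite [RHS]superfunD superfunZ /= /cutoff.
by case: ifP => // _; rewrite scaler0 addr0.
Qed.

(** In the weights other than [w] this is the equality 0 = 0, as pullbacks
    preserve 0. *)
Lemma agree_dmono w i j (F : superfun q (sm_image i)) (G : superfun q (sm_image j)) :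
  agree_weight w F G -> agree (dmono w F) (dmono w G).
Proof.
move=> FG u m mij; rewrite !dmonoE; case: eqP => [->|_]; first exact: FG.
by rewrite (linear_zero (@sm_pullback_linear i j)) mul0r.
Qed.

(** The coefficient of weight v of the image comes from the weight v - lam;
    linearity of the pencil is what keeps the set of weights finite. *)
Definition operator_of_pencil lam (P : pencil_family M)
    (linP : forall w i, linear (P w i)) : density_family M.
Proof.
move=> i f; apply: (@mk_densities R p q _ (fun v => P (v - lam) i (f (v - lam)))).
have [s _ fs] := finite_weights_seq (densitiesP f).
apply: (@sub_finite_set _ _ [set` [seq w + lam | w <- s]]); last exact: finite_seq.
move=> v Pv; apply/mapP; exists (v - lam); last by rewrite subrK.
by apply: fs; apply: contra_neq Pv => ->; exact: (linear_zero (linP _ _)).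
Defined.

(** Every density is a finite sum of monomials. *)
Lemma density_operator_ext lam (P : pencil_family M) (D D' : density_family M) :
  density_operator D -> density_operator D' ->
  restricts_to lam D P -> restricts_to lam D' P -> D = D'.
Proof.
move=> [linD _] [linD' _] DP D'P; apply: functional_extensionality_dep => i.
apply/funext => f; have [s us fs] := densities_seq f.
rewrite (densities_expand us fs) (linear_big (linD i)) (linear_big (linD' i)).
by apply: eq_bigr => w _; rewrite DP D'P.
Qed.

Lemma pencil_of_operator lam (D : density_family M) :
  density_operator D -> has_weight lam D ->
  exists2 P : pencil_family M, operator_pencil lam P & restricts_to lam D P.
Proof.
move=> [linD agD] wD; pose P w i F := D i (dmono w F) (w + lam).
exists P; last first.
  by move=> w i F; have [G DG] := wD i w F; rewrite /P DG dmono_id.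
split=> [w i c F G|w i j F G /agree_dmono FG]; last exact: (agD i j _ _ FG (w + lam)).
by rewrite /P (@dmono_linear R p q) linD.
Qed.

Lemma operator_of_pencilP lam (P : pencil_family M) : operator_pencil lam P ->
  exists2 D : density_family M, density_operator D & restricts_to lam D P.
Proof.
move=> [linP agP]; exists (operator_of_pencil lam linP).
  split=> [i c f g|i j f g fg w]; first by apply: densities_inj => w; exact: linP.
  by have := agP (w - lam) i j _ _ (fg (w - lam)); rewrite subrK.
move=> w i F; apply: densities_inj => v; rewrite [LHS]/= dmonoE -subr_eq.
by case: eqP => [->|_] //; exact: (linear_zero (linP _ _)).
Qed.

End DensitiesOnSupermanifold.

Theorem lemma2p1 (R : realType) (p q : nat) (M : supermanifold R p q)
    (posM : positive_atlas M) (lam : R) :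
  (forall Delta : density_family M, density_operator Delta ->
     (density_diffop_le 2 Delta /\ has_weight lam Delta <->
      exists P : pencil_family M,
        [/\ operator_pencil lam P, quadratic_pencil P &
            restricts_to lam Delta P])) /\
  (forall P : pencil_family M, operator_pencil lam P -> quadratic_pencil P ->
     exists! Delta : density_family M,
       density_operator Delta /\ restricts_to lam Delta P).
Proof.
split=> [Delta opD|P opP _]; last first.
  have [D opD DP] := operator_of_pencilP opP.
  by exists D; split=> // D' [opD' D'P]; exact: density_operator_ext DP D'P.
split=> [[oD wD]|[P [opP quadP DP]]].
  have [P opP DP] := pencil_of_operator opD wD.
  by exists P; split=> // i; apply: dens_diffop_quadratic (oD i) _ => w F; exact: DP.
split=> [i|i w F]; last by exists (P w i F); exact: DP.
have [D0 [A [B [oD0 oA oB PE]]]] := quadP i.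
apply: quadratic_pencil_order oD0 oA oB (opD.1 i) _ => w F.
by rewrite DP PE.
Qed.
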